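(* Let $\mu$ be an irreducible, finitely supported, symmetric probability measure on $\mathrm{Homeo}^+(\mathbf{R})$ such that the group $G$ generated by the support of $\mu$ acts minimally on $\mathbf{R}$. (1) If $G$ has the strong contraction property, then for any $x<y$ and any compact interval $J$, almost surely $$\mathbf{1}_J(X_n^x)\,|X_n^y-X_n^x|\longrightarrow 0\qquad\text{as } n\to\infty.$$ (2) If $G$ satisfies only the weak contraction property, in the sense that $G$ does not have the strong contraction property and is topologically conjugate to a subgroup of $\widetilde{\mathrm{Homeo}}{}^+(\mathbf{S}^1)$ having the weak contraction property, then, after replacing $G$ (and correspondingly $\mu$ and the process $X$) by this conjugate, for any $x<y<x+1$ and any compact interval $J$ the convergence $$\mathbf{1}_J(X_n^x)\,|X_n^y-X_n^x|\longrightarrow 0\qquad\text{as } n\to\infty$$ holds with positive probability.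
   Context: $\mathrm{Homeo}^+(\mathbf{R})$ is the group of orientation-preserving (increasing) homeomorphisms of the real line. A measure $\mu$ on it is symmetric if $\mu(g)=\mu(g^{-1})$ for all $g$, and irreducible if the group $G$ generated by its support has no global fixed point in $\mathbf{R}$. The action of $G$ is minimal if every $G$-orbit is dense in $\mathbf{R}$. Let $g_1,g_2,\dots$ be i.i.d. with distribution $\mu$, $f_n=g_n\circ\cdots\circ g_1$, and $X_n^x=f_n(x)$. $\widetilde{\mathrm{Homeo}}{}^+(\mathbf{S}^1)$ is the group of orientation-preserving homeomorphisms of $\mathbf{R}$ commuting with the translation $x\mapsto x+1$. An irreducible subgroup $G$ of $\mathrm{Homeo}^+(\mathbf{R})$ has the strong contraction property if there exists a compact interval $L$ such that for every compact interval $I$ there is a sequence $(h_n)$ of elements of $G$ with $h_n(I)\subset L$ for all $n$ and the diameter of $h_n(I)$ tending to $0$ as $n\to\infty$. It has the weak contraction property if there is a compact interval $L$ for which the same holds for all compact intervals $I$ of length less than $1$. *)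

(* Defs.v *)
From HB Require Import structures.
From mathcomp Require Import all_boot all_order all_algebra.
From mathcomp Require Import all_classical all_reals all_analysis.

Set Implicit Arguments.
Unset Strict Implicit.
Unset Printing Implicit Defensive.
Import Order.TTheory GRing.Theory Num.Theory.
Import numFieldNormedType.Exports.

Local Open Scope classical_set_scope.
Local Open Scope ring_scope.

(* All homeomorphisms of the line, of either orientation. The inverse is a
   field so that inversion is computable; [homeo_ext] shows that it carries no
   extra information. *)
Record homeo (R : realType) : Type := Homeo {
  homeo_fun :> R -> R;
  homeo_inv : R -> R;
  homeo_funK : cancel homeo_fun homeo_inv;
  homeo_invK : cancel homeo_inv homeo_fun;
  homeo_fun_continuous : continuous homeo_fun;
  homeo_inv_continuous : continuous homeo_inv
}.

Section HomeoGroup.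
Variable R : realType.
Implicit Types f g h : homeo R.

Lemma homeo_ext f g : f =1 g -> f = g.
Proof.
case: f g => [f f' fK f'K fc f'c] [g g' gK g'K gc g'c] /= /funext efg.
subst g.
have efg' : f' = g' by apply/funext => x; rewrite -{1}(g'K x) fK.
by subst g'; congr Homeo; exact: Prop_irrelevance.
Qed.

HB.instance Definition _ := gen_eqMixin (homeo R).
HB.instance Definition _ := gen_choiceMixin (homeo R).

Definition homeo_one : homeo R :=
  @Homeo R id id (frefl _) (frefl _) (fun _ => cvg_id) (fun _ => cvg_id).

Definition homeo_opp f : homeo R :=
  Homeo (homeo_invK f) (homeo_funK f)
    (@homeo_inv_continuous _ f) (@homeo_fun_continuous _ f).

Definition homeo_mul f g : homeo R :=
  @Homeo R (f \o g) (homeo_inv g \o homeo_inv f)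
    (can_comp (homeo_funK f) (homeo_funK g))
    (can_comp (homeo_invK g) (homeo_invK f))
    (fun x => continuous_comp (@homeo_fun_continuous _ g x)
                              (@homeo_fun_continuous _ f _))
    (fun x => continuous_comp (@homeo_inv_continuous _ f x)
                              (@homeo_inv_continuous _ g _)).

Fact homeo_mulA : associative homeo_mul.
Proof. by move=> f g h; exact: homeo_ext. Qed.

Fact homeo_mul1 : left_id homeo_one homeo_mul.
Proof. by move=> f; exact: homeo_ext. Qed.

Fact homeo_mulr1 : right_id homeo_one homeo_mul.
Proof. by move=> f; exact: homeo_ext. Qed.

Fact homeo_mulV : left_inverse homeo_one homeo_opp homeo_mul.
Proof. by move=> f; apply: homeo_ext => x /=; rewrite homeo_funK. Qed.

Fact homeo_mulrV : right_inverse homeo_one homeo_opp homeo_mul.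
Proof. by move=> f; apply: homeo_ext => x /=; rewrite homeo_invK. Qed.

HB.instance Definition _ := isGroup.Build (homeo R)
  homeo_mulA homeo_mul1 homeo_mulr1 homeo_mulV homeo_mulrV.

End HomeoGroup.

Definition homeo_plus (R : realType) : set (homeo R) :=
  [set f | {homo f : x y / x < y}].

(* Orientation-preserving homeomorphisms commuting with x |-> x + 1 *)
Definition homeo_circle_lift (R : realType) : set (homeo R) :=
  [set f | homeo_plus f /\ forall x : R, f (x + 1) = f x + 1].

Definition subgroup_of_type (T : groupType) (H : set T) : Prop :=
  [/\ H 1%g, (forall a b, H a -> H b -> H (a * b)%g)
    & forall a, H a -> H a^-1%g].

Definition generated (T : groupType) (S : set T) : set T :=
  smallest (@subgroup_of_type T) S.

Definition conjugate_set (T : groupType) (phi : T) (G : set T) : set T :=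
  [set (phi * h / phi)%g | h in G].

(* A finitely supported measure on a group is given by its point masses:
   mu g stands for mu({g}). *)
Section FiniteMeasures.
Variables (R : realType) (T : groupType).
Implicit Type mu : T -> R.

Definition msupport mu : set T := [set g | mu g != 0].

Definition finitely_supported_probability mu : Prop :=
  [/\ forall g, 0 <= mu g, finite_set (msupport mu)
    & \sum_(g \in msupport mu) mu g = 1].

Definition symmetric_measure mu : Prop := forall g, mu g = mu g^-1%g.

End FiniteMeasures.

Section Actions.
Variable R : realType.
Implicit Types (G : set (homeo R)) (I L : set R).

Definition has_global_fixpoint G : Prop :=
  exists x : R, forall g, G g -> g x = x.

Definition irreducible_measure (mu : homeo R -> R) : Prop :=
  ~ has_global_fixpoint (generated (msupport mu)).

Definition orbit_of G (x : R) : set R := [set (g : homeo R) x | g in G].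

Definition minimal_action G : Prop := forall x : R, dense (orbit_of G x).

Definition compact_interval I : Prop :=
  exists a b : R, a <= b /\ I = `[a, b]%classic.

Definition diameter I : R := sup [set `|u.1 - u.2| | u in I `*` I].

Definition contractible_into G L I : Prop :=
  exists h : nat -> homeo R,
    [/\ forall n, G (h n), forall n, h n @` I `<=` L
      & diameter (h n @` I) @[n --> \oo] --> (0 : R)].

Definition strong_contraction G : Prop :=
  exists2 L, compact_interval L &
    forall I, compact_interval I -> contractible_into G L I.

(* The diameter of a compact interval is its length. *)
Definition weak_contraction G : Prop :=
  exists2 L, compact_interval L &
    forall I, compact_interval I -> diameter I < 1 -> contractible_into G L I.

End Actions.

Section RandomWalk.
Context d (Omega : measurableType d) (R : realType) (P : probability Omega R).

(* Since mu is carried by a finite set, the law and the independence of the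
   random elements g n are determined by the events [g n = h]. *)
Definition iid_with_law (T : groupType) (mu : T -> R)
    (g : nat -> Omega -> T) : Prop :=
  [/\ forall n h, measurable [set w | g n w = h],
      forall n h, P [set w | g n w = h] = (mu h)%:E
    & forall (s : seq nat) (h : nat -> T), uniq s ->
        fine (P [set w | forall i, i \in s -> g i w = h i]) =
        \prod_(i <- s) fine (P [set w | g i w = h i])].

(* g 0 is the first increment: walk g n = g (n - 1) o ... o g 0. *)
Fixpoint walk (T : groupType) (g : nat -> Omega -> T) (n : nat) (w : Omega)
    : T :=
  if n is m.+1 then (g m w * walk g m w)%g else 1%g.

Definition trajectory (g : nat -> Omega -> homeo R) (x : R) (n : nat)
    (w : Omega) : R := walk g n w x.

Definition local_contraction (g : nat -> Omega -> homeo R) (x y : R)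
    (J : set R) (w : Omega) : Prop :=
  (\1_J (trajectory g x n w) * `|trajectory g y n w - trajectory g x n w|)
    @[n --> \oo] --> (0 : R).

(* Off a null set the g n lie in the support of mu, but on that null set
   nothing is assumed, so E itself need not be measurable. *)
Definition holds_with_positive_probability (E : set Omega) : Prop :=
  exists A : set Omega, [/\ measurable A, A `<=` E & (0 < P A)%E].

End RandomWalk.

(* Main.v *)
(* Let P be the averaging operator of the walk. Solving Dirichlet problems on
   [-n, n] and normalising by a Harnack inequality yields an increasing function h
   with P h = h; by symmetry of mu this is the distribution function of a
   stationary measure. If h had atoms, Riesz's decomposition of a truncation of
   the atoms would bound the expected number of visits to a compact set, which
   recurrence forbids. If h were bounded below, Young's inequality
   [int_0^c s + int_0^c s^-1 >= c^2], strict unless s fixes c, would contradict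
   P h = h in the coordinate h. Hence h is a homeomorphism of the line, and
   optional stopping for h together with the bounded overshoot of monotone maps
   makes the walk recurrent.

   D = h(y) - h(x) is then a nonnegative martingale along pairs of trajectories.
   With strong contraction D becomes arbitrarily small almost surely, since the
   pair returns to a compact set as long as D stays bounded; the maximal
   inequality then forces D -> 0. In the circle case recurrence makes
   h(x + 1) - h(x) a constant k, and D, started below k, leaves every interval
   [eps, k - eps]; by optional stopping it exits at the bottom with probability
   about 1 - D / k > 0. *)
Require Import Defs.
From HB Require Import structures.
From mathcomp Require Import finmap.
From mathcomp Require Import all_boot all_order all_algebra.
From mathcomp Require Import all_classical all_reals all_analysis.
From mathcomp Require Import lra.
Import Order.TTheory GRing.Theory Num.Theory.
Import numFieldNormedType.Exports.
Local Open Scope classical_set_scope.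
Local Open Scope ring_scope.

Set Implicit Arguments.
Unset Strict Implicit.
Unset Printing Implicit Defensive.

(** * Averages, barriers and recurrence *)

Section Averages.
Context {R : realType} {I : finType} {E : Type}.
Variables (m : I -> R) (act : I -> E -> E).
Hypotheses (m_gt0 : forall i, 0 < m i) (m_sum : \sum_i m i = 1).
Implicit Types (f u : E -> R) (T : E -> Prop) (w : seq I) (e : E).

Definition avg f e := \sum_i m i * f (act i e).

Lemma m_ge0 i : 0 <= m i. Proof. exact: ltW. Qed.

Lemma m_le1 i : m i <= 1.
Proof.
by rewrite -m_sum (bigD1 i) //= lerDl sumr_ge0 // => j _; exact: m_ge0.
Qed.

Lemma le_avg f u e : (forall i, f (act i e) <= u (act i e)) ->
  avg f e <= avg u e.
Proof. by move=> fu; apply: ler_sum => i _; rewrite ler_wpM2l ?m_ge0. Qed.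

Lemma avg_cst c e : avg (fun=> c) e = c.
Proof. by rewrite /avg -mulr_suml m_sum mul1r. Qed.

Lemma avgD f u e : avg (fun x => f x + u x) e = avg f e + avg u e.
Proof. by rewrite /avg -big_split; apply: eq_bigr => i _; rewrite mulrDr. Qed.

Lemma avgZ c f e : avg (fun x => c * f x) e = c * avg f e.
Proof. by rewrite /avg mulr_sumr; apply: eq_bigr => i _; rewrite mulrCA. Qed.

Lemma avgN f e : avg (fun x => - f x) e = - avg f e.
Proof. by rewrite /avg -sumrN; apply: eq_bigr => i _; rewrite mulrN. Qed.

Lemma avgB f u e : avg (fun x => f x - u x) e = avg f e - avg u e.
Proof. by rewrite avgD avgN. Qed.

Lemma avg_ge0 f e : (forall x, 0 <= f x) -> 0 <= avg f e.
Proof. by move=> f0; apply: sumr_ge0 => i _; rewrite mulr_ge0 ?m_ge0. Qed.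

Lemma avg_ge_term f i e : (forall x, 0 <= f x) -> m i * f (act i e) <= avg f e.
Proof.
move=> f0; rewrite /avg (bigD1 i) //= lerDl sumr_ge0 // => j _.
by rewrite mulr_ge0 ?m_ge0.
Qed.

Lemma le_avg_cst f e c : (forall i, f (act i e) <= c) -> avg f e <= c.
Proof. by move=> fc; rewrite -(avg_cst c e); exact: le_avg. Qed.

Lemma ge_avg_cst f e c : (forall i, c <= f (act i e)) -> c <= avg f e.
Proof. by move=> fc; rewrite -{1}(avg_cst c e); exact: le_avg. Qed.

(* The least barrier is the probability of ever hitting T, so T is recurrent
   when it is hit almost surely from everywhere. *)
Definition barrier T f :=
  [/\ forall e, 0 <= f e, forall e, ~ T e -> avg f e <= f e
    & forall e, T e -> 1 <= f e].

Definition recurrent T := forall f, barrier T f -> forall e, 1 <= f e.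

(* If f is a barrier with infimum c < 1 then (f - c) / (1 - c) is one too. *)
Lemma recurrent_unif T d : 0 < d ->
  (forall f, barrier T f -> forall e, d <= f e) -> recurrent T.
Proof.
move=> d0 Hd f bf e; rewrite leNgt; apply/negP => fe1.
have [f0 fS f1] := bf.
pose c := inf (range f).
have hl : has_lbound (range f) by exists 0 => _ [x _ <-].
have cf x : c <= f x by apply: ge_inf => //; exists x.
have c1 : 0 < 1 - c by rewrite subr_gt0; exact: le_lt_trans (cf e) fe1.
have H x : c + d * (1 - c) <= f x.
  have -> : (c + d * (1 - c) <= f x) = (d <= (1 - c)^-1 * (f x - c)).
    by rewrite ler_pdivlMl // lerBrDl [d * _]mulrC.
  apply: (Hd (fun y => (1 - c)^-1 * (f y - c))); split=> [y|y Ty|y Ty].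
  - by rewrite mulr_ge0 ?subr_ge0 // invr_ge0 ltW.
  - rewrite avgZ ler_pM2l ?invr_gt0 // avgB avg_cst lerD2r; exact: fS.
  - by rewrite ler_pdivlMl // mulr1 lerD2r f1.
have : c + d * (1 - c) <= c.
  by apply: lb_le_inf => [|_ [x _ <-]]; [exists (f e), e|exact: H].
by rewrite gerDl leNgt mulr_gt0.
Qed.

(** Truncating at 1 makes a barrier superharmonic on [T] as well, where it is only known to be at
    least 1. *)
Lemma barrier_min T f : barrier T f ->
  forall e, avg (fun x => Num.min (f x) 1) e <= Num.min (f e) 1.
Proof.
move=> [f0 fS f1] e; rewrite le_min; apply/andP; split; last first.
  by apply: le_avg_cst => i; rewrite ge_min lexx orbT.
case: (lem (T e)) => Te.
  apply: le_trans (f1 _ Te); apply: le_avg_cst => i.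
  by rewrite ge_min lexx orbT.
by apply: le_trans (fS _ Te); apply: le_avg => i; rewrite ge_min lexx.
Qed.

(** The strong Markov property for barriers: truncated at 1 and divided by [c], [f] becomes a
    barrier for [T]. *)
Lemma barrier_ge T T' f c e : recurrent T -> barrier T' f -> c <= 1 ->
  (forall x, T x -> c <= f x) -> c <= f e.
Proof.
move=> rT bf c1 cf; have [f0 _ _] := bf.
have [c0|c0] := leP c 0; first exact: le_trans (f0 e).
suff : 1 <= c^-1 * Num.min (f e) 1.
  by rewrite ler_pdivlMl // mulr1 le_min => /andP[].
apply: (rT (fun x => c^-1 * Num.min (f x) 1)); split=> [x|x _|x Tx].
- by rewrite mulr_ge0 ?invr_ge0 ?(ltW c0) // le_min f0 ler01.
- by rewrite avgZ ler_pM2l ?invr_gt0 // (barrier_min bf).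
- by rewrite ler_pdivlMl // mulr1 le_min cf.
Qed.

(** [barrier_ge] spreads the lower bound from [T] to all points, and [recurrent_unif] raises it to
    1. *)
Lemma recurrent_trans T T' d : recurrent T -> 0 < d ->
  (forall f, barrier T' f -> forall e, T e -> d <= f e) -> recurrent T'.
Proof.
move=> rT d0 Hd; apply: (@recurrent_unif _ (Num.min d 1)).
  by rewrite lt_min d0 ltr01.
move=> f bf e; apply: (@barrier_ge T T' f (Num.min d 1) e rT bf) => [|x Tx].
  by rewrite ge_min lexx orbT.
by rewrite ge_min (Hd _ bf).
Qed.

Lemma recurrent_sub T T' : recurrent T -> (forall e, T e -> T' e) ->
  recurrent T'.
Proof.
move=> rT TT'; apply: (recurrent_trans rT ltr01) => f [_ _ f1] e /TT'.
exact: f1.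
Qed.

Lemma recurrent_superharmonic T f c : recurrent T ->
  (forall e, 0 <= f e) -> (forall e, avg f e <= f e) ->
  (forall e, T e -> c <= f e) -> forall e, c <= f e.
Proof.
move=> rT f0 fS fc e; have [c0|c0] := leP c 0; first exact: le_trans (f0 e).
suff : 1 <= c^-1 * f e by rewrite ler_pdivlMl // mulr1.
apply: (rT (fun x => c^-1 * f x)); split=> [x|x _|x Tx].
- by rewrite mulr_ge0 ?invr_ge0 ?(ltW c0).
- by rewrite avgZ ler_pM2l ?invr_gt0.
- by rewrite ler_pdivlMl // mulr1 fc.
Qed.

Definition run e w := foldl (fun x i => act i x) e w.
Definition weight w := \prod_(i <- w) m i.

Lemma weight_gt0 w : 0 < weight w.
Proof. by apply: prodr_gt0 => i _. Qed.

Lemma weight_le1 w : weight w <= 1.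
Proof.
rewrite /weight; elim: w => [|i w IH]; first by rewrite big_nil.
by rewrite big_cons mulr_ile1 ?m_ge0 ?m_le1 // ltW // weight_gt0.
Qed.

Lemma run_cat e w w' : run e (w ++ w') = run (run e w) w'.
Proof. by rewrite /run foldl_cat. Qed.

(** Following the letters of [w] is one way to hit [T]. *)
Lemma barrier_word T f w e : barrier T f -> T (run e w) -> weight w <= f e.
Proof.
move=> [f0 fS f1]; elim: w e => [|i w IH] e /=.
  by rewrite /weight big_nil; exact: f1.
move=> /IH{}IH; case: (lem (T e)) => Te.
  by apply: le_trans (f1 _ Te); exact: weight_le1.
apply: le_trans (fS _ Te); apply: le_trans (avg_ge_term i _ f0).
by rewrite /weight big_cons ler_pM2l.
Qed.

(** * Monotone limits of bounded functions *)

Section Suprema.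
Variables (u : nat -> E -> R) (b : R).
Hypotheses (u_nd : forall n e, u n e <= u n.+1 e) (u_b : forall n e, u n e <= b).

Definition usup e := sup (range (u ^~ e)).

Lemma u_mono n k e : (n <= k)%N -> u n e <= u k e.
Proof.
by move=> nk; have : {homo u ^~ e : i j / (i <= j)%N >-> i <= j};
  [apply: homo_leq => // x y z; exact: le_trans|apply].
Qed.

Let hs e : has_sup (range (u ^~ e)).
Proof. by split; [exists (u 0 e), 0%N|exists b => _ [n _ <-]]. Qed.

Lemma usup_ge n e : u n e <= usup e.
Proof. by apply: ub_le_sup; [case: (hs e)|exists n]. Qed.

Lemma usup_le e c : (forall n, u n e <= c) -> usup e <= c.
Proof. by move=> H; apply: ge_sup => [|_ [n _ <-] //]; case: (hs e). Qed.

Lemma usup_adherent e eta : 0 < eta -> exists n, usup e - eta < u n e.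
Proof.
by move=> eta0; have [_ [n _ <-]] := sup_adherent eta0 (hs e); exists n.
Qed.

(** The alphabet is finite, so one index serves all images of [e]; this replaces monotone
    convergence. *)
Lemma avg_usup e eta : 0 < eta -> exists n, avg usup e - eta <= avg (u n) e.
Proof.
move=> eta0.
have /fin_all_exists[N HN] i := usup_adherent (act i e) eta0.
exists (\max_i N i); rewrite -{1}(avg_cst eta e) -avgB; apply: le_avg => i.
by apply: le_trans (u_mono _ (leq_bigmax i)); exact/ltW.
Qed.

Lemma usup_avg_le e : (forall n, avg (u n) e <= u n.+1 e) -> avg usup e <= usup e.
Proof.
move=> H; apply/ler_addgt0Pr => eta /(avg_usup e)[n Hn].
by rewrite -lerBlDr (le_trans Hn) // (le_trans (H n)) // usup_ge.
Qed.

Lemma usup_avg_ge e : (forall n, u n.+1 e <= avg (u n) e) -> usup e <= avg usup e.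
Proof.
move=> H; apply: usup_le => n; apply: le_trans (u_nd _ _) _.
by apply: le_trans (H n) _; apply: le_avg => i; exact: usup_ge.
Qed.

End Suprema.

(** The probability of hitting [T] within [n] steps. *)
Fixpoint hitp T n e : R :=
  if `[< T e >] then 1 else if n is k.+1 then avg (hitp T k) e else 0.

Lemma hitp_T T n e : T e -> hitp T n e = 1.
Proof. by case: n => [|n] /= Te; rewrite asboolT. Qed.

Lemma hitpS T n e : ~ T e -> hitp T n.+1 e = avg (hitp T n) e.
Proof. by move=> /= Te; rewrite asboolF. Qed.

Lemma hitp_ge0 T n e : 0 <= hitp T n e.
Proof.
by elim: n e => [|n IH] e /=; case: asboolP => // _; exact: avg_ge0.
Qed.

Lemma hitp_le1 T n e : hitp T n e <= 1.
Proof.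
by elim: n e => [|n IH] e /=; case: asboolP => // _; exact: le_avg_cst.
Qed.

Lemma hitp_leS T n e : hitp T n e <= hitp T n.+1 e.
Proof.
elim: n e => [|n IH] e; (case: (lem (T e)) => Te; first by rewrite !hitp_T).
  by rewrite /= asboolF // avg_ge0 // => x; exact: hitp_ge0 T 0%N x.
by rewrite !hitpS //; exact: le_avg.
Qed.

Lemma barrier_hitp T f n e : barrier T f -> hitp T n e <= f e.
Proof.
move=> [f0 fS f1]; elim: n e => [|n IH] e;
  (case: (lem (T e)) => Te; first by rewrite hitp_T // f1).
  by rewrite /= asboolF.
by rewrite hitpS //; apply: le_trans (fS _ Te); exact: le_avg.
Qed.

(** The supremum of [hitp T n] over [n] is itself a barrier. *)
Lemma hitp_approx T p e : (forall f, barrier T f -> p <= f e) ->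
  forall eta, 0 < eta -> exists n, p - eta < hitp T n e.
Proof.
move=> Hp eta eta0.
have nd := hitp_leS T; have le1 := hitp_le1 T.
have [n Hn] := usup_adherent le1 e eta0.
exists n; apply: le_lt_trans Hn; rewrite lerD2r; apply: Hp; split=> [x|x Tx|x Tx].
- exact: le_trans (hitp_ge0 T 0%N x) (usup_ge le1 0%N x).
- by apply: (usup_avg_le nd le1) => k; rewrite hitpS.
- by apply: le_trans (usup_ge le1 0%N x); rewrite hitp_T.
Qed.

End Averages.

(** * Symmetric walks on the line *)

(** [mir] sends a letter to one acting as its inverse, and [wt_mir] is the symmetry of the
    measure. *)
Record symwalk (R : realType) (I : finType) := SymWalk {
  wt : I -> R;
  mir : I -> I;
  mov : I -> R -> R;
  wt_gt0 : forall i, 0 < wt i;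
  wt_sum : \sum_i wt i = 1;
  wt_mir : forall i, wt (mir i) = wt i;
  mirK : involutive mir;
  mov_lt : forall i x y, x < y -> mov i x < mov i y;
  movK : forall i, cancel (mov i) (mov (mir i))
}.

Section Reflection.
Context {R : realType} {I : finType} (W : symwalk R I).

Fact reflect_lt i x y : x < y -> - mov W i (- x) < - mov W i (- y).
Proof. by move=> xy; rewrite ltrN2 mov_lt // ltrN2. Qed.

Fact reflectK i : cancel (fun x => - mov W i (- x))
  (fun x => - mov W (mir W i) (- x)).
Proof. by move=> x; rewrite opprK movK opprK. Qed.

Definition reflect_walk : symwalk R I :=
  SymWalk (wt_gt0 W) (wt_sum W) (wt_mir W) (mirK W) reflect_lt reflectK.

Lemma run_reflect w x : run (mov reflect_walk) x w = - run (mov W) (- x) w.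
Proof.
by elim: w x => [|i w IH] x /=; rewrite ?opprK // /run /= -/(run _ _ w) IH opprK.
Qed.

Lemma avg_reflect f x :
  avg (wt reflect_walk) (mov reflect_walk) (fun x => - f (- x)) x
  = - avg (wt W) (mov W) f (- x).
Proof.
by rewrite /avg -sumrN; apply: eq_bigr => i _; rewrite mulrN /= opprK.
Qed.

End Reflection.

Section Walk.
Context {R : realType} {I : finType} (W : symwalk R I).
Implicit Types (h v : R -> R) (x y : R).
Local Notation m := (wt W).
Local Notation s := (mov W).
Local Notation mean := (avg m s).

Lemma mov_le i x y : (s i x <= s i y) = (x <= y).
Proof.
have [xy|yx] := leP x y; last by apply/negbTE; rewrite -ltNge mov_lt.
by move: xy; rewrite le_eqVlt => /orP[/eqP->|/(mov_lt W i)/ltW //]; rewrite lexx.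
Qed.

Lemma mov_ltE i x y : (s i x < s i y) = (x < y).
Proof. by rewrite !ltNge mov_le. Qed.

Lemma movVK i x : s i (s (mir W i) x) = x.
Proof. by rewrite -{1}(mirK W i) movK. Qed.

Lemma run_lt x y w : x < y -> run s x w < run s y w.
Proof. by elim: w x y => //= i w IH x y /(mov_lt W i)/IH. Qed.

Lemma run_le x y w : x <= y -> run s x w <= run s y w.
Proof. by rewrite le_eqVlt => /orP[/eqP->|/(run_lt w)/ltW]. Qed.

Definition word_inv (w : seq I) := rev [seq mir W i | i <- w].

Lemma run_word_inv x w : run s (run s x w) (word_inv w) = x.
Proof.
elim: w x => //= i w IH x; rewrite /word_inv map_cons rev_cons -cats1 run_cat.
by rewrite /word_inv in IH; rewrite [X in run _ X _]IH /run /= movK.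
Qed.

Definition minimal_walk := forall x a b, a < b ->
  exists w, a < run s x w /\ run s x w < b.

Definition beta x := sup (range (s ^~ x)).

Lemma betaP x : (exists i, beta x = s i x) /\ forall i, s i x <= beta x.
Proof.
have [i0 _|nI] := pickP (@predT I); last first.
  by have /eqP := wt_sum W; rewrite big1 ?[0 == _]eq_sym ?oner_eq0 // => i; have := nI i.
have [i Hi] : exists i, forall j, s j x <= s i x.
  by case: (@arg_maxP _ _ I i0 xpredT (s ^~ x)) => // i _ H; exists i => j; exact: H.
have -> : beta x = s i x.
  apply/eqP; rewrite eq_le; apply/andP; split.
    by apply: ge_sup => [|_ [j _ <-] //]; exists (s i x), i.
  by apply: ub_le_sup; [exists (s i x) => _ [j _ <-]|exists i].
by split=> //; exists i.
Qed.

Lemma beta_le x y : x <= y -> beta x <= beta y.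
Proof.
move=> xy; have [[i ->] _] := betaP x; apply: le_trans (proj2 (betaP y) i).
by rewrite mov_le.
Qed.

(** By symmetry the inverse letter sends [x] to at most [beta x], so no step from [beta x] lands
    below [x]. *)
Lemma beta_mov i x : x <= s i (beta x).
Proof. by rewrite -{1}(movVK i x) mov_le; exact: (proj2 (betaP x)). Qed.

Hypothesis Wmin : minimal_walk.

(** A point that no letter moves right is moved left by none either, inverses being letters; all
    words would fix it, against minimality. *)
Lemma mov_moves x : exists i, x < s i x.
Proof.
apply: contrapT => nex.
have sle i : s i x <= x by rewrite leNgt; apply/negP => ?; apply: nex; exists i.
have sx i : s i x = x.
  apply/eqP; rewrite eq_le sle /=.
  by rewrite -{1}(movVK i x) mov_le.
have run_x w : run s x w = x by elim: w => //= i w IH; rewrite /run /= sx.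
have [|w [xw _]] := Wmin x (a := x) (b := x + 1); first by rewrite ltrDl.
by rewrite run_x ltxx in xw.
Qed.

Lemma beta_gt x : x < beta x.
Proof. by have [i xi] := mov_moves x; apply: lt_le_trans xi (proj2 (betaP x) i). Qed.

(* The supremum of a bounded orbit of beta would be moved by no s i. *)
Lemma iter_beta_unbounded x c : exists k, c < iter k beta x.
Proof.
apply: contrapT => nex.
have ub k : iter k beta x <= c by rewrite leNgt; apply/negP => ?; apply: nex; exists k.
have hs : has_sup (range (fun k => iter k beta x)).
  by split; [exists x, 0%N|exists c => _ [k _ <-]].
pose t := sup (range (fun k => iter k beta x)).
have [i ti] := mov_moves t.
have d0 : 0 < t - s (mir W i) t.
  by rewrite subr_gt0 -(mov_ltE i) movVK.
have [_ [k _ <-]] := sup_adherent d0 hs.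
rewrite -/t opprB addrCA subrr addr0 -(mov_ltE i) movVK ltNge => /negP; apply.
apply: le_trans (proj2 (betaP _) i) _.
by apply: ub_le_sup; [case: hs|exists k.+1].
Qed.

Lemma iter_beta_homo x k l : (k <= l)%N -> iter k beta x <= iter l beta x.
Proof.
have : {homo (fun k => iter k beta x) : k l / (k <= l)%N >-> k <= l}.
  by apply: homo_leq => // [? ? ?|n]; [exact: le_trans|exact/ltW/beta_gt].
exact.
Qed.

Definition harmonic h := forall x, mean h x = h x.
Definition nondecr h := {homo h : x y / x <= y}.

(** The increment of [h] over [[x, y]] is the average of its nonnegative increments over the images
    of [[x, y]]; only the term of [i] is kept. *)
Lemma harnack h i x y : nondecr h -> mean h x = h x -> mean h y = h y -> x <= y ->
  m i * (h (s i y) - h (s i x)) <= h y - h x.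
Proof.
move=> hnd hx hy xy; rewrite -hx -hy /avg -sumrB (bigD1 i) //= -mulrBr lerDl.
apply: sumr_ge0 => j _; rewrite -mulrBr mulr_ge0 ?(ltW (wt_gt0 W j)) //.
by rewrite subr_ge0 hnd // mov_le.
Qed.

Definition harnack_cst := \sum_i (m i)^-1.

Lemma le_harnack_cst i r t : m i * r <= t -> 0 <= t -> r <= harnack_cst * t.
Proof.
move=> mr t0; have mi := wt_gt0 W i.
have : r <= (m i)^-1 * t by rewrite ler_pdivlMl.
move/le_trans; apply; rewrite ler_wpM2r // /harnack_cst (bigD1 i) //= lerDl.
by apply: sumr_ge0 => j _; rewrite invr_ge0 ltW // wt_gt0.
Qed.

Section Growth.
Variables (N : R) (v : R -> R).
Hypotheses (v_nd : nondecr v)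
  (v_cst : forall x y, N < x -> N < y -> v x = v y)
  (v_harm : forall x, - N <= x -> x <= N -> mean v x = v x).

Lemma growth_step k : v (iter k.+2 beta 0) - v (iter k.+1 beta 0) <=
  harnack_cst * (v (iter k.+1 beta 0) - v (iter k beta 0)).
Proof.
set x := iter k beta 0; rewrite !iterS -/x.
have x0 : 0 <= x by exact: (iter_beta_homo 0 (leq0n k)).
have xb := ltW (beta_gt x); have bb := ltW (beta_gt (beta x)).
have d0 : 0 <= v (beta x) - v x by rewrite subr_ge0 v_nd.
have [bN|Nb] := leP (beta x) N; last first.
  rewrite (v_cst (lt_le_trans Nb bb) Nb) subrr mulr_ge0 //.
  by apply: sumr_ge0 => j _; rewrite invr_ge0 ltW // wt_gt0.
have [[i Ei] _] := betaP (beta x).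
apply: (@le_harnack_cst i) d0; apply: le_trans _ (harnack i v_nd _ _ xb).
- rewrite Ei ler_pM2l ?wt_gt0 // lerD2l lerN2 v_nd //.
  exact: (proj2 (betaP x) i).
- by apply: v_harm; lra.
- by apply: v_harm; lra.
Qed.

Lemma growth_iter k : v (iter k beta 0) - v 0 <=
  (\sum_(j < k) harnack_cst ^+ j) * (v (beta 0) - v 0).
Proof.
have hc0 : 0 <= harnack_cst by apply: sumr_ge0 => j _; rewrite invr_ge0 ltW // wt_gt0.
have step j : v (iter j.+1 beta 0) - v (iter j beta 0) <=
      harnack_cst ^+ j * (v (beta 0) - v 0).
  elim: j => [|j IH]; first by rewrite expr0 mul1r.
  by apply: le_trans (growth_step j) _; rewrite exprS -mulrA ler_wpM2l.
elim: k => [|k IH]; first by rewrite subrr big_ord0 mul0r.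
rewrite big_ord_recr mulrDl /=; have := step k; move: IH; rewrite iterS; lra.
Qed.

End Growth.

(** [B] depends on [y] alone; this uniformity in [N] and [v] feeds the compactness argument of
    [harmonic_exists]. *)
Lemma growth_bound y : exists B, forall N v, nondecr v ->
  (forall x y, N < x -> N < y -> v x = v y) ->
  (forall x, - N <= x -> x <= N -> mean v x = v x) ->
  v y - v 0 <= B * (v (beta 0) - v 0).
Proof.
have [k yk] := iter_beta_unbounded 0 y.
exists (\sum_(j < k) harnack_cst ^+ j) => N v vnd vc vh.
by apply: le_trans (growth_iter vnd vc vh k); rewrite lerD2r vnd // ltW.
Qed.

(** * The Dirichlet problem on a symmetric interval *)

Section Dirichlet.
Variable N : R.

(** The probability of leaving [[-N, N]] through its right end within [k] steps. *)
Fixpoint diriter k x : R :=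
  if x < - N then 0 else if N < x then 1
  else if k is l.+1 then mean (diriter l) x else 0.

Hypothesis N0 : 0 <= N.

Let diriter_r k x : N < x -> diriter k x = 1.
Proof.
move=> Nx; have xN : (x < - N) = false.
  by apply/negbTE; rewrite -leNgt; move: N0 Nx; lra.
by case: k => [|k] /=; rewrite xN Nx.
Qed.

Let diriter_l k x : x < - N -> diriter k x = 0.
Proof. by case: k => [|k] /= ->. Qed.

Let diriterS k x : - N <= x -> x <= N -> diriter k.+1 x = mean (diriter k) x.
Proof. by move=> h1 h2 /=; rewrite ltNge h1 ltNge h2. Qed.

Let diriter0 x : x <= N -> diriter 0 x = 0.
Proof. by move=> h2 /=; rewrite [N < x]ltNge h2; case: ifP. Qed.

Let diriter_ge0 k x : 0 <= diriter k x.
Proof.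
elim: k x => [|k IH] x /=; do 2![case: ifP => // _].
by apply: avg_ge0 => //; exact: wt_gt0.
Qed.

Let diriter_le1 k x : diriter k x <= 1.
Proof.
elim: k x => [|k IH] x /=; do 2![case: ifP => // _].
by apply: le_avg_cst => //; [exact: wt_gt0|exact: wt_sum].
Qed.

Let diriter_leS k x : diriter k x <= diriter k.+1 x.
Proof.
elim: k x => [|k IH] x.
  by have [xN|Nx] := leP x N; [rewrite diriter0 ?diriter_ge0|rewrite !diriter_r].
have [xN|Nx] := leP x N; last by rewrite !diriter_r.
have [Nx|xN'] := leP (- N) x; last by rewrite !diriter_l.
by rewrite !diriterS //; apply: le_avg => //; exact: wt_gt0.
Qed.

Let diriter_nd k : nondecr (diriter k).
Proof.
elim: k => [|k IH] x y xy;
  (have [yN|Ny] := leP y N; last by rewrite (diriter_r _ Ny));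
  (have [Nx|xN] := leP (- N) x; last by rewrite (diriter_l _ xN)).
  by rewrite !diriter0 //; lra.
rewrite !diriterS //; [|lra..].
by apply: ler_sum => i _; rewrite ler_wpM2l ?(ltW (wt_gt0 W i)) // IH // mov_le.
Qed.

Lemma dirichlet_solution : exists v, [/\ nondecr v, forall x, x < - N -> v x = 0,
  forall x, N < x -> v x = 1 & forall x, - N <= x -> x <= N -> mean v x = v x].
Proof.
exists (usup diriter); split.
- move=> x y xy; apply: (usup_le diriter_le1) => k; apply: le_trans (usup_ge diriter_le1 k y).
  exact: diriter_nd.
- move=> x xN; apply/eqP; rewrite eq_le; apply/andP; split.
    by apply: (usup_le diriter_le1) => k; rewrite diriter_l.
  by apply: le_trans (usup_ge diriter_le1 0%N x); rewrite diriter_l.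
- move=> x xN; apply/eqP; rewrite eq_le; apply/andP; split.
    by apply: (usup_le diriter_le1) => k; rewrite diriter_r.
  by apply: le_trans (usup_ge diriter_le1 0%N x); rewrite diriter_r.
- move=> x Nx xN; have w0 := wt_gt0 W; have w1 := wt_sum W.
  apply/eqP; rewrite eq_le; apply/andP; split.
    by apply: (usup_avg_le w0 w1 diriter_leS diriter_le1) => k; rewrite diriterS.
  by apply: (usup_avg_ge w0 diriter_leS diriter_le1) => k; rewrite diriterS.
Qed.

End Dirichlet.

End Walk.

(** * Existence of a harmonic coordinate *)

(** Compactness of [[a, b]] as an induction principle: the supremum of the points reached from [a]
    can be passed unless it is [b]. *)
Lemma segment_ind (R : realType) (Q : R -> R -> Prop) :
  (forall a b c, a <= b -> b <= c -> Q a b -> Q b c -> Q a c) ->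
  (forall a b a' b', a <= a' -> a' <= b' -> b' <= b -> Q a b -> Q a' b') ->
  (forall x, exists p q, [/\ p < x, x < q & Q p q]) ->
  forall a b, a <= b -> Q a b.
Proof.
move=> Qcat Qsub Qloc a b ab.
pose S := [set t | [/\ a <= t, t <= b & Q a t]].
have Sa : S a.
  have [p [q [pa aq Qpq]]] := Qloc a.
  by split=> //; apply: Qsub Qpq; [exact/ltW|exact: lexx|exact/ltW].
have hs : has_sup S by split; [exists a|exists b => t []].
pose t := sup S.
have [p [q [pt tq Qpq]]] := Qloc t.
have at_ : a <= t by apply: ub_le_sup => //; case: hs.
have [||r [ar rb Qar]] := @sup_adherent _ S (t - p); rewrite ?subr_gt0 //.
rewrite -/t opprB addrCA subrr addr0 => pr.
have rt : r <= t by apply: ub_le_sup; [case: hs|split].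
pose c := Num.min b ((t + q) / 2).
have rc : r <= c by rewrite le_min rb /=; lra.
have cq : c <= q by rewrite ge_min; apply/orP; right; lra.
have Qac : Q a c by apply: (Qcat _ _ _ ar rc Qar); exact: Qsub (ltW pr) rc cq Qpq.
have : c <= t.
  apply: ub_le_sup; first by case: hs.
  by split=> //; [exact: le_trans rc|rewrite ge_min lexx].
rewrite /c ge_min => /orP[bt|]; last by lra.
by move: Qac; rewrite /c; have -> : Num.min b ((t + q) / 2) = b by apply/min_idPl; lra.
Qed.

(* A cluster point of (f n) in the topology of pointwise convergence, taken
   along a nonprincipal ultrafilter. *)
Lemma pointwise_cluster (R : realType) (T : eqType) (f : nat -> T -> R) (B : T -> R) :
  (forall n x, `|f n x| <= B x) ->
  exists h : T -> R, forall (s : seq T) eps N, 0 < eps ->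
    exists2 n, (N <= n)%N & forall x, x \in s -> `|f n x - h x| < eps.
Proof.
move=> fB.
have [U [UU oU]] := ultraFilterLemma (F := \oo) _.
have UP : ProperFilter U := @ultra_proper _ _ UU.
(* The supremum of [S x] is the limit of [f n x] along [U]. *)
pose S x := [set t | U [set n | t <= f n x]].
have fB' n x : - B x <= f n x <= B x by rewrite -ler_norml.
have hs x : has_sup (S x).
  split.
    by exists (- B x); apply: filterS filterT => n _ /=; case/andP: (fB' n x).
  exists (B x) => t /filter_ex[n /= tf]; apply: le_trans tf _.
  by case/andP: (fB' n x).
exists (fun x => sup (S x)) => s eps N eps0.
have close x : U [set n | `|f n x - sup (S x)| < eps].
  have [t St tx] := sup_adherent eps0 (hs x).
  have nS : ~ S x (sup (S x) + eps / 2).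
    move=> /(ub_le_sup (proj2 (hs x))); apply/negP; rewrite -ltNge ltrDl.
    by rewrite divr_gt0.
  have [//|nU] := in_ultra_setVsetC [set n | sup (S x) + eps / 2 <= f n x] UU.
  apply: filterS2 St nU => n /= h1 /negP; rewrite -ltNge => h2.
  by rewrite ltr_norml; apply/andP; split; lra.
have : U [set n | (N <= n)%N /\ forall x, x \in s -> `|f n x - sup (S x)| < eps].
  elim: s => [|y s IH].
    by apply: filterS (oU _ (nbhs_infty_ge N)) => n /= Nn; split.
  apply: filterS2 (close y) IH => n /= h1 [Nn h2]; split=> // x.
  by rewrite inE => /predU1P[->|/h2].
by move=> /filter_ex[n [Nn Hn]]; exists n.
Qed.

Section HarmonicExistence.
Context {R : realType} {I : finType} (W : symwalk R I) (Wmin : minimal_walk W).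
Implicit Types (h v : R -> R) (x y : R).
Local Notation m := (wt W).
Local Notation s := (mov W).
Local Notation mean := (avg m s).

Lemma minimal_reflect : minimal_walk (reflect_walk W).
Proof.
move=> x a b ab; have [|w [aw wb]] := Wmin (- x) (a := - b) (b := - a).
  by rewrite ltrN2.
by exists w; rewrite run_reflect ltrNr ltrNl.
Qed.

Lemma reflect_nondecr v : nondecr v -> nondecr (fun x => - v (- x)).
Proof. by move=> nd x y xy; rewrite lerN2 nd // lerN2. Qed.

(** The growth bound of the reflected walk compares with the increment over [[s i 0, 0]] for some
    letter [i]. One Harnack step passes to [[0, beta W 0]], since [s i (beta W 0)] is at least 0. *)
Lemma decay_bound y : exists2 B, 0 <= B & forall N v, nondecr v -> beta W 0 <= N ->
  (forall x y, x < - N -> y < - N -> v x = v y) ->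
  (forall x, - N <= x -> x <= N -> mean v x = v x) ->
  v 0 - v y <= B * (v (beta W 0) - v 0).
Proof.
have [B HB] := growth_bound minimal_reflect (- y).
have hc0 : 0 <= harnack_cst W by apply: sumr_ge0 => j _; rewrite invr_ge0 ltW // wt_gt0.
exists (`|B| * harnack_cst W) => [|N v vnd bN vc vh]; first by rewrite mulr_ge0.
have b0 := beta_gt Wmin 0.
have := HB N (fun x => - v (- x)) (reflect_nondecr vnd).
rewrite opprK oppr0 => {}HB.
have {}HB : - v y - - v 0 <= B * (- v (- beta (reflect_walk W) 0) - - v 0).
  apply: HB => [x z ? ?|x ? ?]; first by rewrite (vc (- x) (- z)) ?ltrN2.
  by rewrite avg_reflect vh //; lra.
have [[i Ei] _] := betaP (reflect_walk W) 0; have := beta_gt minimal_reflect 0.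
rewrite {}Ei /= oppr0 [- - s i 0]opprK in HB *; rewrite oppr_gt0 => /ltW/vnd s0.
have d0 : 0 <= v (beta W 0) - v 0 by rewrite subr_ge0 vnd // ltW.
have v0 : v 0 - v (s i 0) <= harnack_cst W * (v (beta W 0) - v 0).
  apply: (@le_harnack_cst _ _ _ i) d0.
  apply: le_trans (_ : m i * (v (s i (beta W 0)) - v (s i 0)) <= _).
    by rewrite ler_pM2l ?wt_gt0 // lerD2r vnd // beta_mov.
  by apply: harnack (ltW b0) => //; apply: vh; lra.
have : `|B| * (v 0 - v (s i 0)) <= `|B| * harnack_cst W * (v (beta W 0) - v 0).
  by rewrite -mulrA ler_wpM2l.
have : B * (v 0 - v (s i 0)) <= `|B| * (v 0 - v (s i 0)).
  by rewrite ler_wpM2r ?subr_ge0 // ler_norm.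
by move: HB; lra.
Qed.

Lemma harmonic_exists : exists h,
  [/\ nondecr h, harmonic W h & h 0 < h (beta W 0)].
Proof.
have b0 := beta_gt Wmin 0.
pose N n : R := n%:R + beta W 0.
have N0 n : 0 <= N n by rewrite addr_ge0 // ltW.
have [v Hv] := choice (fun n => dirichlet_solution W (N0 n)).
have v_nd n : nondecr (v n) by case: (Hv n).
have v_l n x : x < - N n -> v n x = 0 by case: (Hv n) => _ + _ _; apply.
have v_r n x : N n < x -> v n x = 1 by case: (Hv n) => _ _ + _; apply.
have v_h n x : - N n <= x -> x <= N n -> mean (v n) x = v n x.
  by case: (Hv n) => _ _ _; apply.
have N_large n c : c <= n%:R -> c < N n by move=> cn; rewrite /N; lra.
pose d n := v n (beta W 0) - v n 0.
have bound y : exists B, forall n, `|v n y - v n 0| <= B * d n.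
  have [B1 HB1] := growth_bound Wmin y; have [B2 B20 HB2] := decay_bound y.
  exists (Num.max B1 B2) => n.
  have d0 : 0 <= d n by rewrite subr_ge0 v_nd // ltW.
  rewrite ler_norml; apply/andP; split.
    rewrite lerNl opprB; apply: le_trans (_ : B2 * d n <= _); last first.
      by rewrite ler_wpM2r // le_max lexx orbT.
    apply: (HB2 (N n)) => //; last exact: v_h.
      by rewrite /N lerDr.
    by move=> x z /v_l-> /v_l->.
  apply: le_trans (_ : B1 * d n <= _); last first.
    by rewrite ler_wpM2r // le_max lexx.
  apply: (HB1 (N n)) => //; last exact: v_h.
  by move=> x z /v_r-> /v_r->.
have [B HB] := choice bound.
(* Were [d n] zero, the bounds would make [v n] constant, but it takes the values 0 and 1. *)
have d_gt0 n : 0 < d n.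
  have d0 : 0 <= d n by rewrite subr_ge0 v_nd // ltW.
  rewrite lt_neqAle d0 andbT eq_sym; apply/eqP => dn0.
  have v0 y : v n y = v n 0.
    by apply/eqP; rewrite -subr_eq0 -normr_le0 (le_trans (HB y n)) // dn0 mulr0.
  have := v0 (N n + 1); rewrite -(v0 (- N n - 1)) v_r ?[v n (_ - 1)]v_l; [|lra..].
  by move/eqP; rewrite oner_eq0.
pose f n x := (v n x - v n 0) / d n.
have fB n x : `|f n x| <= B x.
  by rewrite normrM normfV (gtr0_norm (d_gt0 n)) ler_pdivrMr.
have f_nd n : nondecr (f n).
  by move=> x y xy; rewrite ler_pM2r ?invr_gt0 // lerD2r v_nd.
have f_h n x : - N n <= x -> x <= N n -> mean (f n) x = f n x.
  move=> h1 h2; transitivity (mean (fun y => (d n)^-1 * (v n y - v n 0)) x).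
    by apply: eq_bigr => i _; rewrite [_^-1 * _]mulrC.
  by rewrite avgZ avgB avg_cst ?wt_sum // v_h // mulrC.
have [h Hh] := pointwise_cluster fB.
have h0 x a : (forall n, f n x = a) -> h x = a.
  move=> fx; apply/eqP; rewrite -subr_eq0 -normr_eq0.
  have [//|/eqP hx] := eqVneq; have hx0 : 0 < `|h x - a|.
    by rewrite lt_neqAle eq_sym normr_ge0 andbT; exact/eqP.
  have [n _ /(_ x)] := Hh [:: x] _ 0%N hx0.
  by rewrite mem_head fx distrC ltxx => /(_ isT).
exists h; split.
- move=> x y xy; rewrite leNgt; apply/negP => yx.
  have eps0 : 0 < (h x - h y) / 2 by rewrite divr_gt0 // subr_gt0.
  have [n _ Hn] := Hh [:: x; y] _ 0%N eps0.
  have := Hn x; have := Hn y; rewrite !inE !eqxx orbT => /(_ isT) + /(_ isT).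
  rewrite !ltr_norml => /andP[? ?] /andP[? ?]; have := f_nd n x y xy; lra.
- move=> x; apply/eqP; rewrite -subr_eq0 -normr_le0 leNgt; apply/negP => hx.
  have eps0 : 0 < `|mean h x - h x| / 2 by rewrite divr_gt0.
  have [n /= xn Hn] := Hh (x :: [seq s i x | i <- enum I]) _ (Num.bound `|x|) eps0.
  have xN : `|x| <= N n.
    apply/ltW/N_large/ltW; apply: lt_le_trans (archi_boundP (normr_ge0 x)) _.
    by rewrite ler_nat.
  move: xN; rewrite ler_norml => /andP[xN1 xN2].
  have E : mean h x - h x = mean (fun y => h y - f n y) x + (f n x - h x).
    by rewrite avgB (f_h n) // addrA subrK.
  have : `|mean (fun y => h y - f n y) x| <= `|mean h x - h x| / 2.
    rewrite ler_norml; apply/andP.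
    have Hi i : `|h (s i x) - f n (s i x)| <= `|mean h x - h x| / 2.
      rewrite distrC ltW // Hn // inE; apply/orP; right.
      by apply/mapP; exists i; rewrite ?mem_enum.
    split; [apply: ge_avg_cst|apply: le_avg_cst]; do ?[exact: wt_gt0|exact: wt_sum];
      by move=> i; have := Hi i; rewrite ler_norml => /andP[].
  have := Hn x (mem_head _ _).
  have := ler_normD (mean (fun y => h y - f n y) x) (f n x - h x).
  by rewrite -E; lra.
- have -> : h 0 = 0 by apply: h0 => n; rewrite /f subrr mul0r.
  have -> // : h (beta W 0) = 1.
  by apply: h0 => n; rewrite /f -/(d n) divff // gt_eqF.
Qed.

(** If [h] were flat on [[x, y]], Harnack would make it flat on all images of [[x, y]] under words.
    By minimality these cover the line, and [segment_ind] would make [h] flat on [[0, beta W 0]]. *)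
Lemma harmonic_increasing h : nondecr h -> harmonic W h -> h 0 < h (beta W 0) ->
  forall x y, x < y -> h x < h y.
Proof.
move=> hnd hh h01 x y xy; rewrite lt_neqAle hnd ?(ltW xy) // andbT; apply/eqP => hxy.
have flat w : h (run s y w) <= h (run s x w).
  elim/last_ind: w => [|w i IH]; first by rewrite hxy.
  have E z : run s z (rcons w i) = s i (run s z w) by rewrite -cats1 run_cat.
  have := harnack i hnd (hh (run s x w)) (hh (run s y w)) (run_le W w (ltW xy)).
  have mi := wt_gt0 W i => H.
  by rewrite !E -subr_le0 -(pmulr_rle0 _ mi) (le_trans H) // subr_le0.
have : h (beta W 0) <= h 0.
  apply: (@segment_ind _ (fun a b => h b <= h a)) (ltW (beta_gt Wmin 0)).
  - by move=> a b c _ _ ? ?; exact: le_trans (_ : h b <= _).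
  - move=> a b a' b' aa _ bb hba.
    by apply: le_trans (hnd _ _ bb) _; apply: le_trans hba (hnd _ _ aa).
  move=> z; have [w [xw wy]] := Wmin z xy.
  exists (run s x (word_inv W w)), (run s y (word_inv W w)).
  have := run_lt W (word_inv W w) xw; have := run_lt W (word_inv W w) wy.
  by rewrite run_word_inv => ? ?; split.
by rewrite leNgt h01.
Qed.

End HarmonicExistence.

(** * Visits and atoms *)

Section Visits.
Context {R : realType} {I : finType} (W : symwalk R I).
Implicit Types (f : R -> R) (x y z : R) (A : seq R) (K : pred R).
Local Notation m := (wt W).
Local Notation s := (mov W).
Local Notation mean := (avg m s).

(** The [n]-step transition probability from [x] to [y]. *)
Definition trans n x y : R := iter n mean (fun z => (z == y)%:R) x.

Lemma trans_exchange n x y : mean (trans n ^~ y) x = mean (trans n x) y.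
Proof.
elim: n x y => [|n IH] x y.
  rewrite /avg (reindex_inj (inv_inj (mirK W))); apply: eq_bigr => i _.
  rewrite /trans /= wt_mir; congr (_ * (_ : bool)%:R).
  by rewrite (can2_eq (movVK W i) (movK W i)).
transitivity (\sum_i m i * \sum_j m j * trans n (s i x) (s j y)).
  by apply: eq_bigr => i _; rewrite -[X in _ = _ * X]IH.
under eq_bigr do rewrite mulr_sumr.
rewrite exchange_big; apply: eq_bigr => j _; rewrite /trans /= /avg mulr_sumr.
by apply: eq_bigr => i _; rewrite mulrCA.
Qed.

Lemma trans_sym n x y : trans n x y = trans n y x.
Proof.
elim: n x y => [|n IH] x y; first by rewrite /trans /= eq_sym.
rewrite [LHS](_ : _ = mean (trans n ^~ y) x) //.
rewrite [RHS](_ : _ = mean (trans n ^~ x) y) // trans_exchange.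
by apply: eq_bigr => i _; rewrite IH.
Qed.

Lemma iter_meanZ n c f x : iter n mean (fun y => c * f y) x = c * iter n mean f x.
Proof.
by elim: n x => //= n IH x; rewrite -avgZ; apply: eq_bigr => i _; rewrite IH.
Qed.

Lemma iter_meanB n f f' x :
  iter n mean (fun y => f y - f' y) x = iter n mean f x - iter n mean f' x.
Proof.
by elim: n x => //= n IH x; rewrite -avgB; apply: eq_bigr => i _; rewrite IH.
Qed.

Lemma iter_mean_sum n A (F : R -> R -> R) x :
  iter n mean (fun y => \sum_(a <- A) F a y) x = \sum_(a <- A) iter n mean (F a) x.
Proof.
elim: n x => //= n IH x; rewrite /avg exchange_big; apply: eq_bigr => i _.
by rewrite IH mulr_sumr.
Qed.

Lemma iter_mean_le n f f' x : (forall y, f y <= f' y) ->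
  iter n mean f x <= iter n mean f' x.
Proof.
by move=> ff'; elim: n x => //= n IH x; apply: le_avg => //; exact: wt_gt0.
Qed.

Lemma iter_mean_ge0 n f x : (forall y, 0 <= f y) -> 0 <= iter n mean f x.
Proof. by move=> f0; elim: n x => //= n IH x; apply: avg_ge0 => //; exact: wt_gt0. Qed.

Fixpoint reach n z : seq R :=
  if n is k.+1 then flatten [seq reach k (s i z) | i <- enum I] else [:: z].

Lemma iter_mean_reach n f f' z : (forall y, y \in reach n z -> f y <= f' y) ->
  iter n mean f z <= iter n mean f' z.
Proof.
elim: n z => [|n IH] z H /=; first by apply: H; rewrite mem_head.
apply: le_avg => [|i]; first exact: wt_gt0.
apply: IH => y Hy; apply: H; apply/flattenP; exists (reach n (s i z)) => //.
by apply/mapP; exists i; rewrite ?mem_enum.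
Qed.

(* Riesz: the potential of f - P f is dominated by f, and by symmetry of the
   transition kernel its mass on K counts the visits to K from z. *)
Lemma visits_bounded f K B N z :
  (forall x, 0 <= f x) -> (forall x, mean f x <= f x) ->
  (forall A, uniq A -> all K A -> \sum_(a <- A) f a <= B) ->
  (f z - mean f z) * (\sum_(n < N) iter n mean (fun y => (K y)%:R) z) <= B.
Proof.
move=> f0 fS fB; set r := f z - mean f z.
have r0 : 0 <= r by rewrite subr_ge0.
(* Telescoping: [f - mean f] is nonnegative and equals [r] at [z], so it dominates [r] times the
   indicator of [z]. *)
have riesz M x : r * (\sum_(n < M) trans n x z) <= f x - iter M mean f x.
  elim: M => [|M IH]; first by rewrite big_ord0 mulr0 subrr.
  rewrite big_ord_recr mulrDr.
  apply: le_trans (lerD IH (_ : _ <= iter M mean f x - iter M.+1 mean f x)) _.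
    rewrite iterSr -iter_meanB -iter_meanZ; apply: iter_mean_le => y.
    by case: eqP => [->|_]; rewrite ?mulr1 // mulr0 subr_ge0.
  by rewrite addrA subrK.
pose A := undup [seq y <- flatten [seq reach (n : 'I_N) z | n <- enum 'I_N] | K y].
have uA : uniq A := undup_uniq _.
have KA : all K A by apply/allP => y; rewrite mem_undup mem_filter => /andP[].
apply: le_trans (fB A uA KA).
apply: le_trans (_ : r * \sum_(n < N) \sum_(a <- A) trans n a z <= _); last first.
  rewrite exchange_big mulr_sumr; apply: ler_sum => a _.
  by apply: le_trans (riesz N a) _; rewrite gerBl iter_mean_ge0.
rewrite ler_wpM2l //; apply: ler_sum => n _.
under eq_bigr do rewrite trans_sym /trans.
rewrite -iter_mean_sum; apply: iter_mean_reach => y yn.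
case Ky : (K y); last by apply: sumr_ge0 => a _.
have yA : y \in A.
  rewrite mem_undup mem_filter Ky; apply/flattenP; exists (reach n z) => //.
  by apply/mapP; exists n; rewrite ?mem_enum.
by rewrite (big_rem y) //= eqxx lerDl sumr_ge0.
Qed.

End Visits.

(** * Atoms of a harmonic function *)

Section Jumps.
Context {R : realType} {I : finType} (W : symwalk R I) (Wmin : minimal_walk W).
Implicit Types (x y z : R) (A : seq R) (K : pred R).
Local Notation m := (wt W).
Local Notation s := (mov W).
Local Notation mean := (avg m s).
Variable h : R -> R.
Hypotheses (h_nd : nondecr h) (h_harm : harmonic W h).

(** The mass [h(x+) - h(x-)] of the atom at [x]. *)
Definition jump x := inf [set h u.2 - h u.1 | u in [set u : R * R | u.1 < x /\ x < u.2]].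

Let hi x : has_inf [set h u.2 - h u.1 | u in [set u : R * R | u.1 < x /\ x < u.2]].
Proof.
split; first by exists (h (x + 1) - h (x - 1)), (x - 1, x + 1) => //=; split; lra.
exists 0 => _ [u [u1 u2] <-]; rewrite subr_ge0 h_nd // ltW //; exact: lt_trans u2.
Qed.

Lemma jump_le a b x : a < x -> x < b -> jump x <= h b - h a.
Proof. by move=> ax xb; apply: ge_inf; [case: (hi x)|exists (a, b)]. Qed.

Lemma jump_ge x c : (forall a b, a < x -> x < b -> c <= h b - h a) -> c <= jump x.
Proof.
move=> H; apply: lb_le_inf; first by case: (hi x).
by move=> _ [[a b] [ax xb] <-]; exact: H.
Qed.

Lemma jump_ge0 x : 0 <= jump x.
Proof.
apply: jump_ge => a b ax xb; rewrite subr_ge0 h_nd // ltW //; exact: lt_trans xb.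
Qed.

Lemma jump_superharmonic x : mean jump x <= jump x.
Proof.
apply: jump_ge => a b ax xb; rewrite -(h_harm a) -(h_harm b) -sumrB.
apply: ler_sum => i _; rewrite -mulrBr ler_pM2l ?wt_gt0 //.
by apply: jump_le; rewrite mov_ltE.
Qed.

Lemma sum_jump A a b : uniq A -> (forall x, x \in A -> a < x /\ x < b) ->
  a <= b -> \sum_(x <- A) jump x <= h b - h a.
Proof.
move=> uA HA ab; rewrite -(perm_big _ (permEl (perm_sort <=%R A))) /=.
have : sorted <%R (sort <=%R A) by rewrite sort_lt_sorted.
have {HA} : forall x, x \in sort <=%R A -> a < x /\ x < b.
  by move=> x; rewrite mem_sort; exact: HA.
elim: (sort _ A) a ab {uA} => [|x [|y A'] IH] a ab HA sA.
- by rewrite big_nil subr_ge0 h_nd.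
- by rewrite big_seq1; have [] := HA x (mem_head _ _); exact: jump_le.
move: sA => /= /andP[xy sA].
have [ax xb] := HA x (mem_head _ _).
have yA : y \in [:: x, y & A'] by rewrite !inE eqxx orbT.
have [ay yb] := HA y yA.
pose t := (x + y) / 2; have [xt ty] : x < t /\ t < y by rewrite /t; split; lra.
rewrite big_cons; have -> : h b - h a = (h t - h a) + (h b - h t) by lra.
apply: lerD; first exact: jump_le.
apply: IH => //; first by apply/ltW; exact: lt_trans yb.
move=> z zA; split; last by have [] := HA z; rewrite // inE zA orbT.
move: zA; rewrite inE => /predU1P[->//|zA]; apply: lt_trans ty _.
by move: sA; rewrite lt_path_sortedE => /andP[/allP/(_ z zA)].
Qed.

(** Truncated at [jump x], for an [x] where some letter strictly lowers the jump, the jumps form a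
    superharmonic function that strictly exceeds its mean at [x]. By [visits_bounded] the expected
    visits to [K] would be bounded. *)
Lemma jump_zero :
  (forall z, exists K B, (forall A, uniq A -> all K A -> \sum_(a <- A) jump a <= B) /\
    forall C, exists N, C < \sum_(n < N) iter n mean (fun y => (K y)%:R) z) ->
  forall z, jump z = 0.
Proof.
move=> HK z; apply/eqP; rewrite eq_le jump_ge0 andbT leNgt; apply/negP => z0.
(* Otherwise jumps never decrease along the dense orbit of [z], every interval has increment at
   least [jump z], and [h 1 - h 0] exceeds all multiples of it. *)
have [x [i xi]] : exists x i, jump (s i x) < jump x.
  apply: contrapT => nex.
  have le x i : jump x <= jump (s i x).
    by rewrite leNgt; apply/negP => ?; apply: nex; exists x, i.
  have orb w : jump z <= jump (run s z w).
    elim/last_ind: w => [|w i IH] //; rewrite -cats1 run_cat.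
    exact: le_trans IH (le _ _).
  have big a b : a < b -> jump z <= h b - h a.
    move=> /(Wmin z)[w [aw wb]]; apply: le_trans (orb w) _; exact: jump_le.
  have H2 k : k%:R * jump z <= h 1 - h 0.
    case: k => [|k]; first by rewrite mul0r subr_ge0 h_nd.
    have H3 j : (j <= k.+1)%N -> j%:R * jump z <= h (j%:R / k.+1%:R) - h 0.
      elim: j => [|j IH] jk; first by rewrite !mul0r subrr.
      have : jump z <= h (j.+1%:R / k.+1%:R) - h (j%:R / k.+1%:R).
        by apply: big; rewrite ltr_pM2r ?invr_gt0 ?ltr0n // ltr_nat.
      have := IH (ltnW jk); rewrite -[in X in _ -> _ -> X * _ <= _]natr1 mulrDl mul1r; lra.
    by have := H3 k.+1 (leqnn _); rewrite divff ?pnatr_eq0.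
  have := archi_boundP (_ : 0 <= (h 1 - h 0) / jump z).
  rewrite divr_ge0 ?subr_ge0 ?h_nd ?jump_ge0 // => /(_ isT).
  by rewrite ltr_pdivrMr // ltNge H2.
pose f y := Num.min (jump y) (jump x).
have f0 y : 0 <= f y by rewrite le_min !jump_ge0.
have fS y : mean f y <= f y.
  rewrite le_min; apply/andP; split.
    apply: le_trans (jump_superharmonic y); apply: le_avg => [|j]; first exact: wt_gt0.
    by rewrite ge_min lexx.
  apply: le_avg_cst => [||j]; [exact: wt_gt0|exact: wt_sum|].
  by rewrite ge_min lexx orbT.
have fx : 0 < f x - mean f x.
  rewrite subr_gt0 {2}/f minxx -[X in _ < X](avg_cst s (wt_sum W) _ x).
  rewrite /avg (bigD1 i) //= [X in _ < X](bigD1 i) //=; apply: ltr_leD.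
    by rewrite ltr_pM2l ?wt_gt0 // gt_min xi.
  by apply: ler_sum => j _; rewrite ler_pM2l ?wt_gt0 // ge_min lexx orbT.
have [K [B [KB HN]]] := HK x.
have [N] := HN (B / (f x - mean f x)); rewrite ltr_pdivrMr // mulrC ltNge.
move/negP; apply; apply: visits_bounded => // A uA KA; apply: le_trans (KB A uA KA).
by apply: ler_sum => a _; rewrite ge_min lexx.
Qed.

End Jumps.

(** * Unboundedness of harmonic coordinates *)

Section Unbounded.
Context {R : realType} {I : finType} (W : symwalk R I) (Wmin : minimal_walk W).
Implicit Types (x y z : R) (A : seq R) (K : pred R).
Local Notation m := (wt W).
Local Notation s := (mov W).
Local Notation mean := (avg m s).

Lemma iter_harmonic h n x : harmonic W h -> iter n mean h x = h x.
Proof.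
move=> hh; elim: n x => //= n IH x.
by rewrite -[RHS]hh; apply: eq_bigr => i _; rewrite IH.
Qed.

Lemma seq_lower_bound A : exists a, forall x, x \in A -> a < x.
Proof.
elim: A => [|y A [a IH]]; first by exists 0.
exists (Num.min a (y - 1)) => x; rewrite inE => /predU1P[->|/IH ax].
  by rewrite gt_min; apply/orP; right; lra.
by rewrite gt_min ax.
Qed.

Lemma seq_upper_bound A : exists b, forall x, x \in A -> x < b.
Proof.
have [a Ha] := seq_lower_bound [seq - x | x <- A].
by exists (- a) => x xA; rewrite ltrNr Ha // map_f.
Qed.

(** By Markov's inequality the walk from [z] is in [K] with probability at least one half at each
    time, so its expected visits diverge; nonnegativity of [g] bounds the total jump in [K]. *)
Lemma nonneg_harmonic_jump g : nondecr g -> harmonic W g -> (forall x, 0 <= g x) ->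
  forall z, jump g z = 0.
Proof.
move=> gnd gh g0; apply: (jump_zero Wmin gnd gh) => z.
pose M := 2 * g z + 1; have M0 : 0 < M by have := g0 z; rewrite /M; lra.
pose K := [pred y | g y <= M].
have half n : 2^-1 <= iter n mean (fun y => (K y)%:R) z.
  apply: le_trans (_ : iter n mean (fun y => 1 - M^-1 * g y) z <= _); last first.
    apply: iter_mean_le => y; have [gM|gM] := leP (g y) M.
      have -> : K y = true by [].
      by rewrite lerBlDr lerDl mulr_ge0 ?invr_ge0 ?(ltW M0).
    have -> : K y = false by apply/negbTE; rewrite /K /= -ltNge.
    by rewrite subr_le0 ler_pdivlMl // mulr1 ltW.
  rewrite (iter_meanB W n (fun=> 1)) iter_meanZ iter_harmonic //; last first.
    by move=> x; rewrite avg_cst ?wt_sum.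
  rewrite iter_harmonic // lerBrDr -lerBrDl ler_pdivrMl // /M.
  by have := g0 z; lra.
have visits C : exists N, C < \sum_(n < N) iter n mean (fun y => (K y)%:R) z.
  exists (Num.bound `|C|).*2.
  apply: lt_le_trans (_ : \sum_(n < (Num.bound `|C|).*2) 2^-1 <= _);
    last by apply: ler_sum => n _; exact: half.
  rewrite sumr_const card_ord -mul2n mulrnA -mulr_natr.
  by have := archi_boundP (normr_ge0 C); have := ler_norm C; lra.
have [[b Mb]|nb] := lem (exists b, M < g b).
  exists K, (g b); split=> // A uA /allP AK.
  have [a Ha] := seq_lower_bound (b :: A).
  have ab : a < b by apply: Ha; rewrite mem_head.
  apply: le_trans (sum_jump gnd uA _ (ltW ab)) _; last by rewrite gerBl.
  move=> x xA; split; first by apply: Ha; rewrite inE xA orbT.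
  have Kx : g x <= M := AK x xA.
  by rewrite ltNge; apply/negP => /gnd/(lt_le_trans Mb); rewrite ltNge Kx.
exists K, M; split=> // A uA _.
have [a Ha] := seq_lower_bound (0 :: A); have [b Hb] := seq_upper_bound (0 :: A).
have ab : a <= b.
  by apply: ltW; apply: (@lt_trans _ _ 0); [apply: Ha|apply: Hb]; rewrite mem_head.
apply: le_trans (sum_jump gnd uA _ ab) _.
  by move=> x xA; split; [apply: Ha|apply: Hb]; rewrite inE xA orbT.
have : g b <= M by rewrite leNgt; apply/negP => ?; apply: nb; exists b.
by have := g0 a; lra.
Qed.

Lemma jumpless_close g x e : (forall z, jump g z = 0) -> 0 < e -> nondecr g ->
  exists a b, [/\ a < x, x < b & g b - g a < e].
Proof.
move=> gj e0 gnd; apply: contrapT => nex.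
have := @jump_ge _ g gnd x e; rewrite gj leNgt e0 => H; apply: notF; apply: H => a b ax xb.
by rewrite leNgt; apply/negP => ?; apply: nex; exists a, b.
Qed.

Lemma jumpless_ivt g v a b : (forall z, jump g z = 0) ->
  (forall x y, x < y -> g x < g y) -> g a <= v -> v <= g b -> exists x, g x = v.
Proof.
move=> gj glt ga; have gnd : nondecr g.
  by move=> x y; rewrite le_eqVlt => /predU1P[->//|/glt/ltW].
rewrite le_eqVlt => /predU1P[->|gb]; first by exists b.
pose S := [set x | g x <= v].
have hs : has_sup S.
  split; first by exists a.
  by exists b => x Sx; rewrite leNgt; apply/negP => /glt; rewrite ltNge (le_trans Sx) // ltW.
exists (sup S); apply/eqP; rewrite eq_le; apply/andP; split; rewrite leNgt; apply/negP => gv.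
  have e0 : 0 < g (sup S) - v by rewrite subr_gt0.
  have [p [q [pt tq gpq]]] := jumpless_close (sup S) gj e0 gnd.
  have [||r Sr] := @sup_adherent _ S (sup S - p); rewrite ?subr_gt0 //.
  rewrite opprB addrCA subrr addr0 => /glt pr.
  by have := glt _ _ tq; rewrite /S /= in Sr; lra.
have e0 : 0 < v - g (sup S) by rewrite subr_gt0.
have [p [q [pt tq gpq]]] := jumpless_close (sup S) gj e0 gnd.
have : q <= sup S.
  by apply: ub_le_sup; [case: hs|have := glt _ _ pt; rewrite /S /=; lra].
by rewrite leNgt tq.
Qed.

Lemma count_level (d v : R) n : 0 <= d -> 0 <= v ->
  d * \sum_(j < n) (j.+1%:R * d <= v)%R%:R <= v.
Proof.
move=> d0 v0; elim: n => [|n IH]; first by rewrite big_ord0 mulr0.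
rewrite big_ord_recr /=; have [nv|nv] := leP (n.+1%:R * d) v; last by rewrite addr0.
apply: le_trans nv; rewrite mulrC ler_wpM2r // -natr1 lerD2r.
apply: le_trans (_ : \sum_(j < n) 1 <= _); last by rewrite sumr_const card_ord.
by apply: ler_sum => j _; rewrite lern1 leq_b1.
Qed.

(* Young's inequality, summed over the level points x_k of h with
   h (x_k) = k H / n: the boxes [x_j <= s i x_k] and [x_k <= (s i)^-1 x_j]
   cover the n x n square, which leaves an excess of order n if some s i moves
   the endpoint; harmonicity and symmetry only leave room for H / 2. *)
Lemma harmonic_unbounded_below h : (forall x y, x < y -> h x < h y) ->
  harmonic W h -> forall c, exists x, h x < c.
Proof.
move=> hlt hh c; apply: contrapT => nex.
have hc x : c <= h x by rewrite leNgt; apply/negP => ?; apply: nex; exists x.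
have hs : has_inf (range h) by split; [exists (h 0), 0|exists c => _ [x _ <-]].
pose g x := h x - inf (range h).
have glt x y : x < y -> g x < g y by move=> /hlt; rewrite /g ltrD2r.
have gnd : nondecr g by move=> x y; rewrite le_eqVlt => /predU1P[->//|/glt/ltW].
have gh : harmonic W g by move=> x; rewrite avgB avg_cst ?wt_sum // hh.
have g0 x : 0 <= g x by rewrite subr_ge0; apply: ge_inf; [case: hs|exists x].
have ginf e : 0 < e -> exists x, g x <= e.
  move=> e0; have [_ [x _ <-] xe] := inf_adherent e0 hs.
  by exists x; rewrite /g; lra.
have gj := nonneg_harmonic_jump gnd gh g0.
pose H := g 0; have H0 : 0 < H by apply: le_lt_trans (g0 (-1)) _; rewrite glt // ltrN10.
have [i0 si0] := mov_moves Wmin 0.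
(* Since [i0] lifts 0 strictly above [y], it lifts even all points from the negative [z] on to
   height at least [g y], which is [H + G]. *)
pose y := s i0 0 / 2; pose z := s (mir W i0) y.
have [y0 ys] : 0 < y /\ y < s i0 0 by rewrite /y; split; lra.
have z0 : z < 0 by rewrite -(mov_ltE W i0) movVK.
pose G := g y - H; have G0 : 0 < G by rewrite subr_gt0 glt.
have gz : 0 < H - g z by rewrite subr_gt0 glt.
suff bound n : m i0 * G * (n.+1%:R * (H - g z)) <= H * (H / 2).
  have q0 : 0 < m i0 * G * (H - g z) by rewrite !mulr_gt0 ?wt_gt0.
  have A0 : 0 <= H * (H / 2) / (m i0 * G * (H - g z)).
    by apply: divr_ge0; [rewrite mulr_ge0 ?divr_ge0 ?(ltW H0)|exact: ltW].
  have := archi_boundP A0.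
  set N := Num.bound _; rewrite ltr_pdivrMr //.
  by have := bound N; rewrite -natr1; lra.
pose d := H / n.+1%:R; have d0 : 0 < d by rewrite divr_gt0.
have nd : n.+1%:R * d = H by rewrite mulrC divfK ?pnatr_eq0.
have level (k : 'I_n.+1) : exists x, g x = k.+1%:R * d.
  have [a ga] := ginf _ d0.
  apply: (@jumpless_ivt g _ a 0) => //; first by rewrite (le_trans ga) // ler_peMl ?ler1n // ltW.
  by rewrite -/H -nd ler_pM2r // ler_nat.
have [x xP] := choice level.
have gxH k : g (x k) <= H by rewrite xP -nd ler_pM2r // ler_nat.
have x0 k : x k <= 0 by rewrite leNgt; apply/negP => /glt; rewrite ltNge gxH.
pose box i k j : R := (x j <= s i (x k))%R%:R.
have boxE i k j : box i k j <= (j.+1%:R * d <= g (s i (x k)))%R%:R.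
  rewrite /box ler_nat; case: leP => // /gnd.
  by rewrite xP => ->.
have box_le i k : d * \sum_j box i k j <= g (s i (x k)).
  apply: le_trans (count_level n.+1 (ltW d0) (g0 _)).
  by rewrite ler_pM2l //; apply: ler_sum.
(* All boxes together account for at most [H], while [s i0 (x k)] reaches [H + G] when [x k] is at
   least [z]. *)
have box_gain k : d * \sum_j box i0 k j + (z <= x k)%R%:R * G <= g (s i0 (x k)).
  have [zx|_] := leP z (x k); last by rewrite mul0r addr0.
  rewrite mul1r.
  have yx : g y <= g (s i0 (x k)) by rewrite gnd // -(movVK W i0 y) mov_le.
  have : d * \sum_j box i0 k j <= d * \sum_(j < n.+1) 1.
    by rewrite ler_pM2l //; apply: ler_sum => j _; rewrite lern1 leq_b1.
  by rewrite sumr_const card_ord [d * _%:R]mulrC nd /G; lra.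
pose B := \sum_i m i * \sum_k \sum_j box i k j.
have young : n.+1%:R * n.+1%:R <= B + B.
  have -> : B + B = \sum_i m i * \sum_k \sum_j (box i k j + box (mir W i) j k).
    under [RHS]eq_bigr => i _.
      under eq_bigr do rewrite big_split /=.
      rewrite big_split mulrDr [X in m i * X + _]/= [X in _ + _ * X]exchange_big /=.
      over.
    rewrite big_split; congr (_ + _).
    rewrite /B (reindex_inj (inv_inj (mirK W))); apply: eq_bigr => i _.
    by rewrite wt_mir.
  apply: le_trans (_ : \sum_i m i * (n.+1%:R * n.+1%:R) <= _).
    by rewrite -mulr_suml wt_sum mul1r.
  apply: ler_sum => i _.
  rewrite ler_pM2l ?wt_gt0 //.
  have -> : n.+1%:R * n.+1%:R = \sum_(k < n.+1) \sum_(j < n.+1) (1 : R).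
    by rewrite !sumr_const !card_ord mulr_natr.
  apply: ler_sum => k _; apply: ler_sum => j _; rewrite /box.
  have [_|xx] := leP (x j) (s i (x k)); first by rewrite lerDl ler0n.
  have -> : x k <= s (mir W i) (x j) by rewrite -(mov_le W i) movVK ltW.
  by rewrite add0r.
pose C := \sum_k (z <= x k)%R%:R : R.
have gain : d * B + m i0 * G * C <= \sum_k g (x k).
  have -> : \sum_k g (x k) = \sum_i m i * \sum_k g (s i (x k)).
    under eq_bigr do rewrite -gh /avg; rewrite exchange_big; apply: eq_bigr => i _.
    by rewrite mulr_sumr.
  have -> : d * B = \sum_i m i * \sum_k d * \sum_j box i k j.
    by rewrite mulr_sumr; apply: eq_bigr => i _; rewrite mulrCA -mulr_sumr.
  rewrite (bigD1 i0) //= [X in _ <= X](bigD1 i0) //= addrAC -mulrA -mulrDr.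
  apply: lerD; last first.
    apply: ler_sum => i _; rewrite ler_pM2l ?wt_gt0 //.
    by apply: ler_sum => k _; exact: box_le.
  rewrite ler_pM2l ?wt_gt0 // [G * C]mulrC /C mulr_suml -big_split /=.
  by apply: ler_sum => k _; exact: box_gain.
have total : \sum_k g (x k) = d * (n.+1%:R * (n.+1%:R + 1) / 2).
  under eq_bigr do rewrite xP mulrC; rewrite -mulr_sumr; congr (_ * _).
  elim: n.+1 => [|k IH]; first by rewrite big_ord0 !mul0r.
  by rewrite big_ord_recr IH /= -[k.+1%:R]natr1; lra.
have most : H - g z <= d * C.
  have := count_level n.+1 (ltW d0) (g0 z).
  have : n.+1%:R <= C + \sum_(j < n.+1) (j.+1%:R * d <= g z)%R%:R.
    rewrite /C -big_split /= -[X in X%:R]card_ord -sumr_const; apply: ler_sum => k _.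
    have [_|xz] := leP z (x k); first by rewrite lerDl ler0n.
    by rewrite -xP gnd ?add0r // ltW.
  by rewrite -(ler_pM2l d0) mulrDr mulrC nd; lra.
have mG : 0 < m i0 * G by rewrite mulr_gt0 ?wt_gt0.
have e1 : d * (n.+1%:R * n.+1%:R) <= d * (B + B) by rewrite ler_pM2l.
(* Young bounds [d * B] below by half of [d * n.+1 ^ 2]; compared with [total] this leaves
   [d * n.+1 / 2], that is [H / 2]. *)
have e2 : m i0 * G * C <= H / 2 by move: nd e1 gain; rewrite total; lra.
have e3 : m i0 * G * (n.+1%:R * (H - g z)) <= m i0 * G * (H * C).
  by rewrite ler_pM2l // -[in leRHS]nd -mulrA ler_pM2l ?ltr0n.
apply: le_trans e3 _; rewrite mulrCA ler_pM2l //.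
Qed.

End Unbounded.

(** * Recurrence *)

Section Recurrence.
Context {R : realType} {I : finType} (W : symwalk R I) (Wmin : minimal_walk W).
Implicit Types (x y z b c : R) (f h : R -> R).
Local Notation m := (wt W).
Local Notation s := (mov W).
Local Notation mean := (avg m s).
Let m0 := wt_gt0 W.
Let m1 := wt_sum W.

(** From any point of [[a, b)], choosing [N] times a letter that attains [beta] leads beyond [b].
    Each choice has weight at least the inverse of [harnack_cst], so the hitting probability is
    uniformly positive. *)
Lemma strip_recurrent a b : recurrent m s (fun x => x < a \/ b <= x).
Proof.
have [N bN] := iter_beta_unbounded Wmin a b.
have [j _] := mov_moves Wmin 0.
have hc_ge i : (m i)^-1 <= harnack_cst W.
  rewrite /harnack_cst (bigD1 i) //= lerDl sumr_ge0 // => k _.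
  by rewrite invr_ge0 ltW.
have hc1 : 1 <= harnack_cst W.
  by apply: le_trans (hc_ge j); rewrite invf_ge1 // (m_le1 m0 m1).
have hc0 : 0 < harnack_cst W := lt_le_trans ltr01 hc1.
have hcV i : (harnack_cst W)^-1 <= m i by rewrite invf_ple ?posrE.
apply: (recurrent_unif m1 (d := (harnack_cst W)^-1 ^+ N)).
  by rewrite exprn_gt0 // invr_gt0.
move=> f [f0 fS f1] x.
have [xa|ax] := ltP x a.
  by apply: le_trans (f1 x (or_introl xa)); rewrite exprn_ile1 ?invr_ge0 ?invf_le1 ?(ltW hc0).
have bNx : b <= iter N (beta W) x.
  apply: le_trans (ltW bN) _; elim: (N) => //= k IH; exact: beta_le.
elim: N x bNx {bN ax} => [|k IH] x bx; first by rewrite expr0; apply: f1; right.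
case: (lem (x < a \/ b <= x)) => Tx.
  by apply: le_trans (f1 x Tx); rewrite exprn_ile1 ?invr_ge0 ?invf_le1 ?(ltW hc0).
apply: le_trans (fS x Tx).
have [[i Ei] _] := betaP W x.
apply: le_trans (avg_ge_term s m0 i x f0); rewrite exprS.
by apply: ler_pM; rewrite ?exprn_ge0 ?invr_ge0 ?(ltW hc0) // -Ei IH // -iterSr.
Qed.

(* Optional stopping for c - h, which is positive below beta b because a jump
   over b lands below beta b. *)
Lemma ray_recurrent h b : (forall x y, x < y -> h x < h y) -> harmonic W h ->
  recurrent m s (fun x => b <= x).
Proof.
move=> hlt hh f bf x; have [f0 fS f1] := bf.
have [/f1//|xb] := leP b x; rewrite leNgt; apply/negP => fx.
have hle y z : y <= z -> h y <= h z.
  by rewrite le_eqVlt => /predU1P[->//|/hlt/ltW].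
pose c := h (beta W b).
have hc y : y < b -> h y < c by move=> yb; apply: hlt; exact: lt_trans (beta_gt Wmin b).
pose u y := if y < b then c - h y else 0.
have u0 y : 0 <= u y by rewrite /u; case: ifP => // /hc; lra.
have uS y : y < b -> mean u y <= u y.
  move=> yb; rewrite {2}/u yb -(hh y) -[c](avg_cst s m1 c y) -avgB.
  apply: le_avg => // i; rewrite /u; case: ifP => // _.
  rewrite subr_ge0; apply: hle; apply: le_trans (proj2 (betaP W b) i).
  by rewrite mov_le ltW.
(* Taken so far left that [f + u / (c - h a)], a barrier for leaving [[a, b)], is below 1 at [x],
   against [strip_recurrent]. *)
have [a' ha'] := harmonic_unbounded_below Wmin hlt hh (c - u x / (1 - f x)).
pose a := Num.min a' (b - 1).
have ab : a < b by rewrite gt_min; apply/orP; right; lra.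
have ha : h a < c - u x / (1 - f x).
  by apply: le_lt_trans ha'; apply: hle; rewrite ge_min lexx.
have ca : 0 < c - h a by have := hc a ab; lra.
suff bar : barrier m s (fun y => y < a \/ b <= y) (fun y => f y + (c - h a)^-1 * u y).
  have := strip_recurrent bar x => /=.
  have : u x < (1 - f x) * (c - h a) by rewrite mulrC -ltr_pdivrMr ?subr_gt0 //; lra.
  by rewrite mulrC -ltr_pdivrMl // => ?; lra.
split=> [y|y Ty|y [ya|/f1]].
- by rewrite addr_ge0 ?mulr_ge0 ?invr_ge0 ?(ltW ca).
- have yb : y < b by rewrite ltNge; apply/negP => ?; apply: Ty; right.
  rewrite avgD avgZ lerD //; first by apply: fS; rewrite leNgt yb.
  by rewrite ler_pM2l ?invr_gt0 // uS.
- have yb : y < b := lt_trans ya ab.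
  have : 1 <= (c - h a)^-1 * u y.
    by rewrite /u yb ler_pdivlMl // mulr1 lerD2l lerN2 hle // ltW.
  by have := f0 y; lra.
- have : 0 <= (c - h a)^-1 * u y by rewrite mulr_ge0 ?invr_ge0 ?(ltW ca).
  lra.
Qed.

End Recurrence.

(** * Recurrence of intervals and the continuous harmonic coordinate *)

Section Coordinate.
Context {R : realType} {I : finType} (W : symwalk R I) (Wmin : minimal_walk W).
Implicit Types (x y z b c : R) (f h : R -> R).
Local Notation m := (wt W).
Local Notation s := (mov W).
Local Notation mean := (avg m s).
Let m0 := wt_gt0 W.
Let m1 := wt_sum W.

Lemma reflect_harmonic h : harmonic W h ->
  harmonic (reflect_walk W) (fun x => - h (- x)).
Proof. by move=> hh x; rewrite avg_reflect hh. Qed.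

Lemma reflect_increasing h : (forall x y, x < y -> h x < h y) ->
  forall x y, x < y -> - h (- x) < - h (- y).
Proof. by move=> hlt x y xy; rewrite ltrN2 hlt // ltrN2. Qed.

Lemma harmonic_unbounded_above h : (forall x y, x < y -> h x < h y) ->
  harmonic W h -> forall c, exists x, c < h x.
Proof.
move=> hlt hh c.
have [x hx] := harmonic_unbounded_below (minimal_reflect Wmin)
  (reflect_increasing hlt) (reflect_harmonic hh) (- c).
by exists (- x); rewrite ltrN2 in hx.
Qed.

Lemma left_ray_recurrent h b : (forall x y, x < y -> h x < h y) -> harmonic W h ->
  recurrent m s (fun x => x <= b).
Proof.
move=> hlt hh f [f0 fS f1] x; rewrite -[x]opprK.
apply: (ray_recurrent (minimal_reflect Wmin) (b := - b) (reflect_increasing hlt)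
  (reflect_harmonic hh) (f := fun x => f (- x))); split=> [y //|y yb|y yb].
- have /fS : ~ (- y <= b) by rewrite lerNl.
  move=> H; apply: (le_trans _ H); apply: ler_sum => i _.
  by rewrite /= opprK.
- by apply: f1; rewrite lerNl.
Qed.

(* A step can jump over neither end of this interval without landing in it. *)
Lemma interval_recurrent h b : (forall x y, x < y -> h x < h y) -> harmonic W h ->
  recurrent m s (fun x => b <= x /\ x <= beta W b).
Proof.
move=> hlt hh f [f0 fS f1] x.
have [xb|bx] := ltP x b.
  (* A step across [b] from the left lands in the interval, where [f] is at least 1; so setting [f]
     to 1 from [b] on gives a barrier for the ray. *)
  have := ray_recurrent Wmin (b := b) hlt hh (f := fun y => if y < b then f y else 1) _ x.
  rewrite /= xb; apply; split=> [y|y /negP|y]; first by case: ifP.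
  - rewrite -ltNge => yb; rewrite yb.
    have /fS : ~ (b <= y /\ y <= beta W b) by rewrite leNgt yb => -[].
    move=> H; apply: (le_trans _ H); apply: le_avg => // i.
    case: ltP => // byi; apply: f1.
    by split=> //; apply: le_trans (proj2 (betaP W b) i); rewrite mov_le ltW.
  - by rewrite ltNge => ->.
have [xb|bx'] := leP x (beta W b); first exact: f1.
have := left_ray_recurrent (b := beta W b) hlt hh
  (f := fun y => if beta W b < y then f y else 1) _ x.
rewrite /= bx'; apply; split=> [y|y /negP|y]; first by case: ifP.
- rewrite -ltNge => yb; rewrite yb.
  have /fS : ~ (b <= y /\ y <= beta W b) by rewrite [y <= _]leNgt yb => -[].
  move=> H; apply: (le_trans _ H); apply: le_avg => // i.
  case: ltP => // byi; apply: f1.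
  by split=> //; apply: le_trans (beta_mov W i b) _; rewrite mov_le ltW.
- by rewrite leNgt => /negbTE->.
Qed.

(** Let [w] be the limit of the expected visits truncated at [k]. If its infimum [c] were below [k],
    then, a visit adding 1, [w] would be at least the smaller of [c + 2^-1] and [k] on [K], hence
    everywhere by recurrence. *)
Lemma visits_unbounded (K : pred R) : recurrent m s K ->
  forall z C, exists N, C < \sum_(n < N) iter n mean (fun y => (K y)%:R) z.
Proof.
move=> rK z C.
pose V N x := \sum_(n < N) iter n mean (fun y => (K y)%:R) x.
have V0 N x : 0 <= V N x by apply: sumr_ge0 => n _; apply: iter_mean_ge0.
have VS N x : V N.+1 x = (K x)%:R + mean (V N) x.
  rewrite /V big_ord_recl; congr (_ + _); rewrite /avg.
  by under [RHS]eq_bigr do rewrite mulr_sumr; rewrite exchange_big.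
have VN N x : V N x <= V N.+1 x.
  by rewrite /V [leRHS]big_ord_recr lerDl; apply: iter_mean_ge0.
pose k : R := `|C| + 1; have k0 : 0 <= k by rewrite addr_ge0.
pose u N x := Num.min (V N x) k.
have u_nd N x : u N x <= u N.+1 x.
  by rewrite le_min !ge_min VN lexx orbT.
have u_k N x : u N x <= k by rewrite ge_min lexx orbT.
have u0 N x : 0 <= u N x by rewrite le_min V0.
have uS N x : mean (u N) x <= u N.+1 x.
  rewrite le_min; apply/andP; split; last exact: le_avg_cst.
  rewrite VS.
  apply: le_trans (_ : mean (V N) x <= _); last by rewrite lerDr.
  by apply: le_avg => // i; rewrite ge_min lexx.
pose w := usup u.
have w0 x : 0 <= w x := le_trans (u0 0%N x) (usup_ge u_k 0%N x).
have wS x : mean w x <= w x by apply: (usup_avg_le m0 m1 u_nd u_k) => n.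
pose c := inf (range w).
have hl : has_lbound (range w) by exists 0 => _ [x _ <-].
have cw x : c <= w x by apply: ge_inf => //; exists x.
have kc : k <= c.
  rewrite leNgt; apply/negP => ck.
  have : Num.min (c + 2^-1) k <= c.
    apply: lb_le_inf => [|_ [x _ <-]]; first by exists (w z), z.
    apply: (recurrent_superharmonic rK w0 wS) => y Ky.
    have [|N] := avg_usup s m0 m1 u_nd u_k y (eta := 2^-1); first by lra.
    move=> HN; apply: le_trans (usup_ge u_k N.+1 y).
    rewrite le_min; apply/andP; split; last by rewrite ge_min lexx orbT.
    rewrite ge_min VS Ky (_ : true%:R = 1 :> R) //; apply/orP; left.
    have : c <= mean w y by apply: ge_avg_cst.
    have : mean (u N) y <= mean (V N) y by apply: le_avg => // i; rewrite ge_min lexx.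
    by rewrite -/w in HN *; lra.
  by rewrite ge_min leNgt ltrDl invr_gt0 ltr0n /= leNgt ck.
have [N HN] := usup_adherent u_k z (ltr01 : 0 < 1 :> R).
exists N; rewrite -/(V N z); have := le_trans kc (cw z); rewrite -/w in HN.
have : u N z <= V N z by rewrite ge_min lexx.
have := ler_norm C; rewrite /k; lra.
Qed.

Lemma harmonic_jumpless h : (forall x y, x < y -> h x < h y) -> harmonic W h ->
  forall z, jump h z = 0.
Proof.
move=> hlt hh.
have hnd : nondecr h by move=> x y; rewrite le_eqVlt => /predU1P[->//|/hlt/ltW].
apply: (jump_zero Wmin hnd hh) => z.
pose K := [pred x | (0 <= x) && (x <= beta W 0)].
have b0 := beta_gt Wmin 0.
exists K, (h (beta W 0 + 1) - h (- 1)); split.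
  move=> A uA /allP AK; apply: sum_jump => //; last by lra.
  by move=> x /AK/andP[? ?]; split; lra.
apply: visits_unbounded.
apply: (recurrent_sub _ _ (interval_recurrent (b := 0) hlt hh)) => //.
by move=> x [h1 h2]; apply/andP.
Qed.

(** The third clause encodes continuity, which for a monotone [h] is the absence of jumps. *)
Lemma harmonic_coordinate : exists h,
  [/\ forall x y, x < y -> h x < h y, harmonic W h,
    forall x e, 0 < e -> exists a b, [/\ a < x, x < b & h b - h a < e]
    & forall c, exists x, c < h x].
Proof.
have [h [hnd hh h01]] := harmonic_exists Wmin.
have hlt := harmonic_increasing Wmin hnd hh h01.
exists h; split=> //; last exact: harmonic_unbounded_above.
by move=> x e e0; apply: jumpless_close => //; exact: harmonic_jumpless.
Qed.

End Coordinate.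

(** * Pairs of trajectories *)

Section Pairs.
Context {R : realType} {I : finType} (W : symwalk R I) (Wmin : minimal_walk W).
Implicit Types (x y z a b c e : R) (u : R * R).
Local Notation m := (wt W).
Local Notation s := (mov W).
Local Notation mean := (avg m s).
Let m0 := wt_gt0 W.
Let m1 := wt_sum W.

Definition mov2 i u := (s i u.1, s i u.2).

Lemma run_mov2 u w : run mov2 u w = (run s u.1 w, run s u.2 w).
Proof. by elim: w u => [|i w IH] [x y] //; rewrite /run /= -/(run _ _ w) IH. Qed.

Lemma hitp_mov2 (K : R -> Prop) n u :
  hitp m mov2 (fun u => K u.1) n u = hitp m s K n u.1.
Proof.
elim: n u => [|n IH] u /=; case: asboolP => // _.
by apply: eq_bigr => i _; rewrite IH.
Qed.

(** A barrier on pairs may depend on both coordinates, whereas [hitp] depends on the first alone;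
    the bound is carried over through it. *)
Lemma recurrent_mov2 (K : R -> Prop) : recurrent m s K ->
  recurrent m mov2 (fun u => K u.1).
Proof.
move=> rK f bf u; apply/ler_addgt0Pr => eta eta0.
have [n Hn] := hitp_approx m0 m1 (e := u.1) (fun g bg => rK g bg u.1) eta0.
by rewrite -lerBlDr (le_trans (ltW Hn)) // -hitp_mov2; exact: barrier_hitp.
Qed.

Definition contracts l0 l1 a b := forall eps, 0 < eps ->
  exists w, [/\ l0 <= run s a w, run s b w <= l1 & run s b w - run s a w < eps].

Variable h : R -> R.
Hypotheses (h_lt : forall x y, x < y -> h x < h y) (h_harm : harmonic W h)
  (h_cont : forall x e, 0 < e -> exists a b, [/\ a < x, x < b & h b - h a < e])
  (h_unb : forall c, exists x, c < h x).

Let h_le x y : x <= y -> h x <= h y.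
Proof. by rewrite le_eqVlt => /predU1P[->//|/h_lt/ltW]. Qed.

Let h_ltE x y : (h x < h y) = (x < y).
Proof.
by apply/idP/idP => [|/h_lt//]; apply: contraTT; rewrite -!leNgt; exact: h_le.
Qed.

Lemma uniformly_continuous_coordinate l0 l1 e : 0 < e -> exists2 eta, 0 < eta &
  forall x y, l0 <= x -> x <= l1 -> y - x < eta -> h y - h x < e.
Proof.
move=> e0; have [l01|l10] := leP l0 l1; last first.
  by exists 1 => // x y h1 h2; have := le_lt_trans (le_trans h1 h2) l10; rewrite ltxx.
apply: (@segment_ind _ (fun a b => exists2 eta, 0 < eta &
  forall x y, a <= x -> x <= b -> y - x < eta -> h y - h x < e)) l01.
- move=> a b c ab bc [d1 d10 H1] [d2 d20 H2].
  exists (Num.min d1 d2) => [|x y ax xc]; first by rewrite lt_min d10.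
  rewrite lt_min => /andP[y1 y2].
  by have [xb|/ltW bx] := leP x b; [exact: H1|exact: H2].
- move=> a b a' b' aa _ bb [d d0 H]; exists d => // x y ax xb; apply: H.
    exact: le_trans ax.
  exact: le_trans xb bb.
move=> z; have [p [q [pz zq hpq]]] := h_cont z e0.
exists p, ((z + q) / 2); split=> //; first by lra.
exists ((q - z) / 2) => [|x y px xq yx]; first by lra.
have : h p <= h x by apply: h_le.
have : h y <= h q by apply: h_le; lra.
lra.
Qed.

Lemma contracts_coordinate l0 l1 a b e : a <= b -> contracts l0 l1 a b -> 0 < e ->
  exists w, h (run s b w) - h (run s a w) < e.
Proof.
move=> ab Hc e0; have [eta eta0 H] := uniformly_continuous_coordinate l0 l1 e0.
have [w [h1 h2 h3]] := Hc _ eta0; exists w; apply: H => //.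
by apply: le_trans h2; exact: run_le.
Qed.

(** Barriers live on all pairs; since letters preserve order, truncating at 0 makes the gap
    nonnegative and still harmonic. *)
Definition gap u := Num.max 0 (h u.2 - h u.1).

Lemma gap_ge0 u : 0 <= gap u.
Proof. by rewrite le_max lexx. Qed.

Lemma gapE u : u.1 <= u.2 -> gap u = h u.2 - h u.1.
Proof. by move=> xy; apply/max_idPr; rewrite subr_ge0 h_le. Qed.

Lemma gap_gt0 u : 0 < gap u -> u.1 < u.2.
Proof. by rewrite lt_max ltxx /= subr_gt0 h_ltE. Qed.

Lemma gap_harmonic u : avg m mov2 gap u = gap u.
Proof.
have [xy|/ltW yx] := leP u.1 u.2.
  rewrite gapE // -(h_harm u.2) -(h_harm u.1) -sumrB; apply: eq_bigr => i _.
  by rewrite gapE /= ?mulrBr // mov_le.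
have gap0 u' : u'.2 <= u'.1 -> gap u' = 0.
  by move=> ?; apply/max_idPl; rewrite subr_le0 h_le.
by rewrite gap0 // /avg big1 // => i _; rewrite gap0 ?mulr0 //= mov_le.
Qed.

(** Optional stopping for the martingale [gap]: the function [f + gap / M] is a barrier for the exit
    set. *)
Lemma gap_exit_hit e M f : 0 < M ->
  recurrent m mov2 (fun u => gap u <= e \/ M <= gap u) ->
  barrier m mov2 (fun u => gap u <= e) f -> forall u, 1 - gap u / M <= f u.
Proof.
move=> M0 rT [f0 fS f1] u; rewrite lerBlDr mulrC.
apply: (rT (fun u => f u + M^-1 * gap u)); split=> [v|v Tv|v [ev|Mv]].
- by rewrite addr_ge0 ?f0 // mulr_ge0 ?gap_ge0 // invr_ge0 ltW.
- rewrite avgD avgZ gap_harmonic lerD2r; apply: fS => ev; apply: Tv; by left.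
- by rewrite ler_wpDr ?f1 // mulr_ge0 ?gap_ge0 // invr_ge0 ltW.
- by rewrite ler_wpDl ?f0 // ler_pdivlMl // mulr1.
Qed.

(** * Hitting small gaps under strong contraction *)

Section Strong.
Hypothesis strong : exists l0 l1, forall a b, a <= b -> contracts l0 l1 a b.

(** When the first point is in [[0, beta W 0]] and the gap is below [M], the second lies below a
    fixed [y]; one word contracting [[0, y]] serves all these pairs. *)
Lemma strong_gap_exit e M : 0 < e ->
  recurrent m mov2 (fun u => gap u <= e \/ M <= gap u).
Proof.
move=> e0; have [l0 [l1 Hc]] := strong.
have [y hy] := h_unb (Num.max (h (beta W 0)) (h (beta W 0) + M)).
move: hy; rewrite gt_max h_ltE => /andP[by_ hM].
have y0 : 0 <= y by apply/ltW/(lt_trans _ by_); exact: beta_gt.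
have [w Hw] := contracts_coordinate y0 (Hc 0 y y0) e0.
apply: (recurrent_trans m0 m1 (d := weight m w)
  (recurrent_mov2 (interval_recurrent Wmin (b := 0) h_lt h_harm))).
  exact: weight_gt0.
move=> f bf u [u0 ub].
case: (lem (gap u <= e \/ M <= gap u)) => Tu.
  by case: bf => _ _ /(_ _ Tu); apply: le_trans; exact: weight_le1.
apply: (barrier_word m0 m1 bf); left; rewrite run_mov2.
have eu : e < gap u by rewrite ltNge; apply/negP => ?; apply: Tu; left.
have uM : gap u < M by rewrite ltNge; apply/negP => ?; apply: Tu; right.
have u12 := gap_gt0 (lt_trans e0 eu).
rewrite gapE /= ?run_le ?(ltW u12) //.
have uy : u.2 <= y.
  rewrite leNgt -h_ltE; rewrite gapE ?(ltW u12) // in uM.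
  by apply/negP; have := h_le ub; lra.
have := h_le (run_le W w uy); have := h_le (run_le W w u0); lra.
Qed.

Lemma strong_hit e : 0 < e -> recurrent m mov2 (fun u => gap u <= e).
Proof.
move=> e0 f bf u; rewrite leNgt; apply/negP => fu.
(* Makes [gap u / M] less than [1 - f u]; the added 1 keeps [M] positive when the gap is 0. *)
pose M := (gap u + 1) / (1 - f u).
have gu := gap_ge0 u.
have M0 : 0 < M by rewrite divr_gt0 ?subr_gt0 //; lra.
have := gap_exit_hit M0 (strong_gap_exit (M := M) e0) bf u.
have : gap u / M < 1 - f u; last by lra.
rewrite ltr_pdivrMr // /M mulrC divfK ?gt_eqF ?subr_gt0 //; lra.
Qed.

End Strong.

(** A word leading [z] into the target also works near [z], so by compactness the hitting
    probability is bounded below on the recurrent interval [[0, beta W 0]]. *)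
Lemma open_recurrent (u v : R) : u < v -> recurrent m s (fun x => u < x /\ x < v).
Proof.
move=> uv.
have [d d0 Hd] : exists2 d, 0 < d & forall f x,
    barrier m s (fun x => u < x /\ x < v) f -> 0 <= x -> x <= beta W 0 -> d <= f x.
  apply: (@segment_ind _ (fun a b => exists2 d, 0 < d & forall f x,
    barrier m s (fun x => u < x /\ x < v) f -> a <= x -> x <= b -> d <= f x))
    (ltW (beta_gt Wmin 0)).
  - move=> a b c ab bc [d1 d10 H1] [d2 d20 H2].
    exists (Num.min d1 d2) => [|f x bf ax xc]; first by rewrite lt_min d10.
    rewrite ge_min; have [xb|/ltW bx] := leP x b; first by rewrite H1.
    by rewrite (H2 f x) ?orbT.
  - move=> a b a' b' aa _ bb [d d0 H]; exists d => // f x bf ax xb; apply: H => //.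
      exact: le_trans ax.
    exact: le_trans xb bb.
  move=> z; have [w [uw wv]] := Wmin z uv.
  have := run_lt W (word_inv W w) uw; have := run_lt W (word_inv W w) wv.
  rewrite run_word_inv; set p := run s u _; set q := run s v _ => zq pz.
  exists ((p + z) / 2), ((z + q) / 2); split; [lra|lra|].
  exists (weight m w) => [|f x bf px xq]; first exact: weight_gt0.
  apply: (barrier_word m0 m1 bf).
  have wK y : run s (run s y (word_inv W w)) w = y.
    have := run_word_inv W y (word_inv W w); congr (run s _ _ = _).
    rewrite /word_inv map_rev revK -map_comp map_id_in // => i _ /=; exact: mirK.
  by split; [rewrite -(wK u)|rewrite -(wK v)]; apply: run_lt; rewrite -/p -/q; lra.
apply: (recurrent_trans m0 m1 (interval_recurrent Wmin (b := 0) h_lt h_harm) d0).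
by move=> f bf x [x0 xb]; exact: Hd.
Qed.

(** * Periodic walks under weak contraction *)

Section Weak.
Hypothesis periodic : forall i x, s i (x + 1) = s i x + 1.
Hypothesis weak : exists l0 l1, forall a b, a <= b -> b - a < 1 -> contracts l0 l1 a b.

Definition period := h 1 - h 0.

(** As letters commute with the translation, [F] is superharmonic. By continuity it is at least
    [F y - e] near [y], hence everywhere by recurrence; so [F] is constant. *)
Lemma periodE x : h (x + 1) - h x = period.
Proof.
pose F y := h (y + 1) - h y.
have F0 y : 0 <= F y by rewrite subr_ge0 h_le // lerDl.
have FS y : mean F y <= F y.
  rewrite /F -(h_harm y) -(h_harm (y + 1)) -sumrB.
  by apply: ler_sum => i _; rewrite periodic mulrBr.
suff le y z : F y <= F z.
  rewrite /period -{2}[1]add0r; apply/eqP; rewrite eq_le.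
  by apply/andP; split; exact: le.
apply/ler_addgt0Pr => e e0; rewrite -lerBlDr.
have e20 : 0 < e / 2 by rewrite divr_gt0.
have [a [b [ay yb hab]]] := h_cont y e20.
have [a' [b' [ay' yb' hab']]] := h_cont (y + 1) e20.
have uv : Num.max a (a' - 1) < Num.min b (b' - 1).
  by rewrite gt_max !lt_min; apply/andP; split; apply/andP; split; lra.
apply: (recurrent_superharmonic (open_recurrent uv) F0 FS) => t [].
rewrite gt_max lt_min => /andP[at_ at'] /andP[tb tb'].
have h1 : h t <= h b by apply: h_le; exact: ltW.
have h2 : h a' <= h (t + 1) by apply: h_le; lra.
have h3 : h a <= h y by apply: h_le; exact: ltW.
have h4 : h (y + 1) <= h b' by apply: h_le; exact: ltW.
by rewrite /F; lra.
Qed.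

(** All pairs with first point near [z] and gap between [e] and [period - e] lie in one interval of
    length less than 1, which a single word contracts; compactness makes its weight uniform. *)
Lemma weak_gap_exit e : 0 < e ->
  recurrent m mov2 (fun u => gap u <= e \/ period - e <= gap u).
Proof.
move=> e0; have [l0 [l1 Hc]] := weak.
have [d d0 Hd] : exists2 d, 0 < d & forall f u,
    barrier m mov2 (fun u => gap u <= e \/ period - e <= gap u) f ->
    0 <= u.1 -> u.1 <= beta W 0 -> d <= f u.
  apply: (@segment_ind _ (fun a b => exists2 d, 0 < d & forall f u,
    barrier m mov2 (fun u => gap u <= e \/ period - e <= gap u) f ->
    a <= u.1 -> u.1 <= b -> d <= f u)) (ltW (beta_gt Wmin 0)).
  - move=> a b c ab bc [d1 d10 H1] [d2 d20 H2].
    exists (Num.min d1 d2) => [|f x bf ax xc]; first by rewrite lt_min d10.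
    rewrite ge_min; have [xb|/ltW bx] := leP x.1 b; first by rewrite H1.
    by rewrite (H2 f x) ?orbT.
  - move=> a b a' b' aa _ bb [d d0 H]; exists d => // f x bf ax xb; apply: H => //.
      exact: le_trans ax.
    exact: le_trans xb bb.
  move=> z; have [a' [b' [az zb hab]]] := h_cont (z + 1) e0.
  (* As [p] exceeds [a' - 1], the interval from [p] to [Num.max p a'] is shorter than 1. As [q] is
     below [b' - 1], a second point beyond [a'] would force a gap above [period - e]. *)
  pose p := ((a' - 1) + z) / 2; pose q := ((b' - 1) + z) / 2.
  have [pz zq] : p < z /\ z < q by rewrite /p /q; split; lra.
  have pa : p <= Num.max p a' by rewrite le_max lexx.
  have pa1 : Num.max p a' - p < 1.
    by rewrite ltrBlDr gt_max; apply/andP; split; rewrite /p; lra.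
  have [w Hw] := contracts_coordinate pa (Hc _ _ pa pa1) e0.
  exists p, q; split=> //; exists (weight m w) => [|f u bf pu uq].
    exact: weight_gt0.
  case: (lem (gap u <= e \/ period - e <= gap u)) => Tu.
    by case: bf => _ _ /(_ _ Tu); apply: le_trans; exact: weight_le1.
  apply: (barrier_word m0 m1 bf); left; rewrite run_mov2.
  have eu : e < gap u by rewrite ltNge; apply/negP => ?; apply: Tu; left.
  have uM : gap u < period - e by rewrite ltNge; apply/negP => ?; apply: Tu; right.
  have u12 := gap_gt0 (lt_trans e0 eu).
  rewrite gapE /= ?run_le ?(ltW u12) //.
  have uy : u.2 <= Num.max p a'.
    rewrite le_max; apply/orP; right; rewrite leNgt -h_ltE.
    rewrite gapE ?(ltW u12) // -(periodE u.1) in uM.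
    have : h (u.1 + 1) <= h b' by apply: h_le; move: uq; rewrite /q; lra.
    by move=> ?; apply/negP; lra.
  have := h_le (run_le W w uy); have := h_le (run_le W w pu); lra.
apply: (recurrent_trans m0 m1 (d := d)
  (recurrent_mov2 (interval_recurrent Wmin (b := 0) h_lt h_harm)) d0).
by move=> f bf u [u0 ub]; exact: Hd.
Qed.

Lemma weak_hit u : u.1 < u.2 -> u.2 < u.1 + 1 -> exists2 p, 0 < p &
  forall e f, 0 < e -> barrier m mov2 (fun u => gap u <= e) f -> p <= f u.
Proof.
move=> u12 u21; have gu : gap u < period.
  by rewrite gapE ?(ltW u12) // -(periodE u.1) ltrD2r h_lt.
have g0 := gap_ge0 u; have p0 : 0 < period by exact: le_lt_trans gu.
(* Half of [1 - gap u / period]; the factor absorbs the loss from stopping at [period - e'] instead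
   of [period]. *)
exists ((period - gap u) / (2 * period)) => [|e f e0 bf].
  by apply: divr_gt0; lra.
pose e' := Num.min e ((period - gap u) / 2).
have e'0 : 0 < e' by rewrite lt_min e0 divr_gt0 ?subr_gt0.
have e'2 : e' <= (period - gap u) / 2 by rewrite ge_min lexx orbT.
have M0 : 0 < period - e' by lra.
have rT : recurrent m mov2 (fun u => gap u <= e \/ period - e' <= gap u).
  apply: (recurrent_sub m0 m1 (weak_gap_exit e'0)) => v [ve|]; [left|by right].
  by apply: le_trans ve _; rewrite ge_min lexx.
apply: le_trans (gap_exit_hit M0 rT bf u).
rewrite lerBrDr -lerBrDl.
apply: le_trans (_ : gap u / ((period + gap u) / 2) <= _).
  by rewrite ler_wpM2l // lef_pV2 ?posrE //; lra.
rewrite ler_pdivrMr; last by lra.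
have -> : (1 - (period - gap u) / (2 * period)) * ((period + gap u) / 2) =
    ((2 * period - (period - gap u)) * ((period + gap u) / 2)) / (2 * period).
  rewrite [RHS]mulrAC [(2 * period - _) / _]mulrBl divff //.
  by rewrite mulf_neq0 // gt_eqF.
rewrite ler_pdivlMr; last by lra.
have : 0 <= (period - gap u) * (period - gap u) by rewrite mulr_ge0 // subr_ge0 ltW.
lra.
Qed.

End Weak.

(** By compactness [h (z + eta) - h z] is at least some [t > 0] on [[j0, j1]]; once the gap is below
    [t], the points are closer than [eta] whenever [x n] is in the interval. *)
Lemma vanishing_gap j0 j1 (x y : nat -> R) : (forall n, x n < y n) ->
  (forall e, 0 < e -> exists N, forall n, (N <= n)%N -> h (y n) - h (x n) < e) ->
  (\1_`[j0, j1]%classic (x n) * `|y n - x n|) @[n --> \oo] --> (0 : R).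
Proof.
move=> xy hxy; apply/cvgrPdist_lt => eta eta0.
have [j01|j10] := leP j0 j1; last first.
  apply: nearW => n; rewrite indicE memNset ?mul0r ?subrr ?normr0 //=.
  by rewrite in_itv /= => /andP[h1 h2]; have := le_lt_trans (le_trans h1 h2) j10; rewrite ltxx.
have [t t0 Ht] : exists2 t, 0 < t & forall z, j0 <= z -> z <= j1 -> t <= h (z + eta) - h z.
  apply: (@segment_ind _ (fun a b => exists2 t, 0 < t &
    forall z, a <= z -> z <= b -> t <= h (z + eta) - h z)) j01.
  - move=> a b c ab bc [d1 d10 H1] [d2 d20 H2].
    exists (Num.min d1 d2) => [|z ax xc]; first by rewrite lt_min d10.
    rewrite ge_min; have [xb|/ltW bx] := leP z b; first by rewrite H1.
    by rewrite (H2 z) ?orbT.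
  - move=> a b a' b' aa _ bb [d d0 H]; exists d => // z ax xb; apply: H => //.
      exact: le_trans ax.
    exact: le_trans xb bb.
  move=> z; exists (z - eta / 4), (z + eta / 4); split; [lra|lra|].
  exists (h (z + eta / 2) - h (z + eta / 4)) => [|v zv vz].
    by rewrite subr_gt0 h_lt //; lra.
  have : h (z + eta / 2) <= h (v + eta) by apply: h_le; lra.
  have : h v <= h (z + eta / 4) by exact: h_le.
  lra.
have [N HN] := hxy t t0; exists N => // n /= /HN hn.
rewrite sub0r normrN normrM normr_id indicE.
have [xJ|_] := boolP (x n \in _); last by rewrite normr0 mul0r.
rewrite normr1 mul1r gtr0_norm ?subr_gt0 //.
move: xJ; rewrite inE /= in_itv /= => /andP[jx xj].
rewrite ltrBlDr addrC -h_ltE; have := Ht _ jx xj; lra.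
Qed.

End Pairs.

(** * Random words and almost sure convergence *)

Section Words.
Context {R : realType} {I : finType} {E : Type}.
Variables (m : I -> R) (act : I -> E -> E).
Hypotheses (m_gt0 : forall i, 0 < m i) (m_sum : \sum_i m i = 1).
Implicit Types (w : seq I) (Q : pred (seq I)) (T : E -> Prop).

Fixpoint words n : seq (seq I) :=
  if n is k.+1 then [seq i :: w | i <- enum I, w <- words k] else [:: [::]].

Lemma mem_words n w : (w \in words n) = (size w == n).
Proof.
elim: n w => [|n IH] w; first by rewrite inE size_eq0.
apply/allpairsP/idP => [[[i v] /= [_ + ->]]|]; first by rewrite IH eqSS.
by case: w => // i w; rewrite eqSS -IH => wn; exists (i, w); rewrite mem_enum.
Qed.

Lemma words_uniq n : uniq (words n).
Proof.
elim: n => // n IH; apply: allpairs_uniq => //; first exact: enum_uniq.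
by move=> [i w] [j v] _ _ [-> ->].
Qed.

Definition pr n Q := \sum_(w <- words n | Q w) weight m w.

Lemma pr0 Q : pr 0 Q = (Q [::])%:R.
Proof. by rewrite /pr big_mkcond big_seq1 /weight big_nil; case: (Q _). Qed.

Lemma prS n Q : pr n.+1 Q = \sum_i m i * pr n (fun w => Q (i :: w)).
Proof.
rewrite /pr big_mkcond /= big_allpairs_dep /= big_enum; apply: eq_bigr => i _.
rewrite mulr_sumr [RHS]big_mkcond; apply: eq_bigr => w _.
by rewrite /weight big_cons.
Qed.

Lemma pr_true n : pr n xpredT = 1.
Proof.
elim: n => [|n IH]; first by rewrite pr0.
by rewrite prS; under eq_bigr do rewrite IH mulr1.
Qed.

Lemma pr_false n : pr n xpred0 = 0.
Proof. by rewrite /pr big_pred0. Qed.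

Lemma eq_pr n Q Q' : Q =1 Q' -> pr n Q = pr n Q'.
Proof. by move=> QQ; apply: eq_bigl. Qed.

Lemma pr_diff n Q Q' : pr n Q - pr n Q' <= pr n (fun w => Q w && ~~ Q' w).
Proof.
rewrite lerBlDr /pr big_mkcond [X in X + _]big_mkcond [X in _ + X]big_mkcond -big_split.
apply: ler_sum => w _; have w0 := ltW (weight_gt0 m_gt0 w).
by case: (Q w); case: (Q' w); rewrite /= ?addr0 ?add0r.
Qed.

Fixpoint hits T e w : bool :=
  `[< T e >] || (if w is i :: w' then hits T (act i e) w' else false).

Lemma hits_run T e w : T (run act e w) -> hits T e w.
Proof.
elim: w e => [|i w IH] e /= Te; first by rewrite asboolT.
by rewrite IH ?orbT.
Qed.

Lemma hits_take T e n w : hits T e (take n w) -> hits T e w.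
Proof.
elim: w n e => [|i w IH] [|n] e //=; first by rewrite orbF => ->.
by move=> /orP[->//|/IH->]; rewrite orbT.
Qed.

Lemma pr_hits T e n k : pr (n + k) (fun w => hits T e (take n w)) = hitp m act T n e.
Proof.
elim: n e => [|n IH] e.
  transitivity (pr (0 + k) (fun=> `[< T e >])).
    by apply: eq_pr => w; rewrite take0 /= orbF.
  by rewrite /=; case: `[< T e >]; rewrite ?pr_true ?pr_false.
rewrite addSn prS /= ; case: asboolP => Te /=.
  by under eq_bigr do rewrite pr_true mulr1.
by apply: eq_bigr => i _; rewrite IH.
Qed.

Section Excursions.
Variables (D : E -> R) (eps lam : R).
Hypotheses (D0 : forall e, 0 <= D e) (DS : forall e, avg m act D e <= D e)
  (eps0 : 0 <= eps) (lam0 : 0 < lam).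

(* After the first time that D <= eps, D later reaches lam. *)
Fixpoint excursion e w : bool :=
  if `[< D e <= eps >] then hits (fun e => lam <= D e) e w
  else if w is i :: w' then excursion (act i e) w' else false.

(** The maximal inequality: [D / lam] is a barrier for the set where [D] is at least [lam]. *)
Lemma pr_exceeds e n : pr n (hits (fun e => lam <= D e) e) <= D e / lam.
Proof.
have -> : pr n (hits (fun e => lam <= D e) e) =
    pr (n + 0) (fun w => hits (fun e => lam <= D e) e (take n w)).
  rewrite addn0 /pr big_seq_cond [RHS]big_seq_cond; apply: eq_bigl => w.
  by rewrite mem_words; case: eqP => //= <-; rewrite take_size.
rewrite pr_hits mulrC; apply: (barrier_hitp m_gt0 (f := fun e => lam^-1 * D e)).
split=> [x|x _|x Dx].
- by rewrite mulr_ge0 ?invr_ge0 ?(ltW lam0).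
- by rewrite avgZ ler_pM2l ?invr_gt0.
- by rewrite ler_pdivlMl // mulr1.
Qed.

(** Induction on the letters read until [D] first drops to [eps]; from there the maximal inequality
    applies. *)
Lemma pr_excursion e n : pr n (excursion e) <= eps / lam.
Proof.
elim: n e => [|n IH] e; have [De|De] := boolP (`[< D e <= eps >]).
1,3: apply: le_trans (_ : pr _ (hits (fun e => lam <= D e) e) <= _);
  [by rewrite le_eqVlt; apply/orP; left; apply/eqP; apply: eq_pr => -[|i w] /=; rewrite De
  |apply: le_trans (pr_exceeds e _) _; rewrite ler_pM2r ?invr_gt0 //; exact/asboolP].
  by rewrite pr0 /= (negbTE De) mulr_ge0 ?invr_ge0 ?(ltW lam0).
rewrite prS /= (negbTE De) -[X in _ <= X]mul1r -m_sum mulr_suml.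
by apply: ler_sum => i _; rewrite ler_wpM2l // ltW.
Qed.

Lemma excursionP e w : hits (fun e => D e <= eps) e w -> ~~ excursion e w ->
  D (run act e w) < lam.
Proof.
elim: w e => [|i w IH] e /=; case: ifPn => De; rewrite ?orbF //=; last exact: IH.
  by move=> _ /negP Dl; rewrite ltNge; apply/negP => ?; apply: Dl; rewrite asboolT.
move=> _; apply: contraR; rewrite -leNgt => Dl.
by rewrite (@hits_run _ (act i e)) ?orbT.
Qed.

End Excursions.

Lemma excursion_take (D : E -> R) eps lam e n w :
  excursion D eps lam e (take n w) -> excursion D eps lam e w.
Proof.
elim: w n e => [|i w IH] [|n] e //=; case: ifP => // De; last exact: IH.
  by rewrite orbF => ->.
by move=> /orP[->//|/hits_take->]; rewrite orbT.
Qed.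

End Words.

(** * From weights of words to probabilities of events *)

Section Process.
Context {R : realType} {I : finType} (m : I -> R).
Hypotheses (m_gt0 : forall i, 0 < m i) (m_sum : \sum_i m i = 1).
Context (T : groupType) (sigma : I -> T) (sigma_inj : injective sigma).
Variable mu : T -> R.
Hypothesis mu_sigma : forall i, mu (sigma i) = m i.
Context d (Omega : measurableType d) (P : probability Omega R) (g : nat -> Omega -> T).
Hypothesis g_iid : iid_with_law P mu g.
Implicit Types (w : seq I) (Q : pred (seq I)).

Definition cyl w : set Omega :=
  [set om | forall k, k \in iota 0 (size w) -> g k om = nth 1%g (map sigma w) k].

Lemma cyl_measurable w : measurable (cyl w).
Proof.
have [gm _ _] := g_iid; rewrite /cyl.
elim: (iota 0 (size w)) => [|k s IH].
  by rewrite [X in measurable X](_ : _ = setT) //; apply/seteqP; split.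
rewrite [X in measurable X](_ : _ = [set om | g k om = nth 1%g (map sigma w) k] `&`
  [set om | forall j, j \in s -> g j om = nth 1%g (map sigma w) j]).
  exact: measurableI.
apply/seteqP; split => om /=.
  by move=> H; split=> [|j js]; apply: H; rewrite inE ?eqxx // js orbT.
by move=> [H1 H2] j; rewrite inE => /predU1P[->|/H2].
Qed.

Lemma cyl_proba w : P (cyl w) = (weight m w)%:E.
Proof.
have [gm gP gI] := g_iid.
rewrite -[LHS]fineK ?fin_num_measure //; last exact: cyl_measurable.
rewrite /cyl gI ?iota_uniq //; congr (_%:E).
under eq_bigr do rewrite gP /=.
have -> : weight m w = \prod_(x <- map sigma w) mu x.
  by rewrite big_map; apply: eq_bigr.
by rewrite [RHS](big_nth 1%g) size_map /index_iota subn0.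
Qed.

Lemma cyl_take w n : cyl w `<=` cyl (take n w).
Proof.
move=> om H k; rewrite !mem_iota !add0n /= size_take_min leq_min => /andP[kn kw].
by rewrite map_take nth_take // H // mem_iota.
Qed.

Lemma cyl_inj w w' om : size w = size w' -> cyl w om -> cyl w' om -> w = w'.
Proof.
move=> ww' H H'; apply: (inj_map sigma_inj); apply: (@eq_from_nth _ 1%g).
  by rewrite !size_map.
by move=> k; rewrite size_map => kw; rewrite -H ?mem_iota // -H' // mem_iota -ww'.
Qed.

Definition evs (L : seq (seq I)) : set Omega := [set om | exists2 w, w \in L & cyl w om].

Lemma evs_cons w L : evs (w :: L) = cyl w `|` evs L.
Proof.
apply/seteqP; split=> om.
  by move=> [v]; rewrite inE => /predU1P[->|vL] H; [left|right; exists v].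
by move=> [H|[v vL H]]; [exists w|exists v]; rewrite ?inE ?eqxx ?vL ?orbT.
Qed.

Lemma evs_nil : evs [::] = set0.
Proof. by apply/seteqP; split=> // om [w]. Qed.

Lemma evs_measurable L : measurable (evs L).
Proof.
elim: L => [|w L IH]; first by rewrite evs_nil.
by rewrite evs_cons; apply: measurableU => //; exact: cyl_measurable.
Qed.

Lemma evs_proba n L : uniq L -> (forall w, w \in L -> size w = n) ->
  P (evs L) = (\sum_(w <- L) weight m w)%:E.
Proof.
elim: L => [|w L IH] /=; first by rewrite evs_nil measure0 big_nil.
move=> /andP[wL uL] Ln; rewrite evs_cons.
rewrite measureU; [|exact: cyl_measurable|exact: evs_measurable|]; last first.
  apply/seteqP; split=> // om [H [v vL H']]; move: wL.
  by rewrite (cyl_inj _ H H') ?vL // !Ln // inE ?eqxx // vL orbT.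
rewrite big_cons EFinD; congr (_ + _)%E; first exact: cyl_proba.
by apply: IH => // v vL; apply: Ln; rewrite inE vL orbT.
Qed.

Definition ev n Q : set Omega := evs [seq w <- words n | Q w].

Lemma ev_measurable n Q : measurable (ev n Q).
Proof. exact: evs_measurable. Qed.

Lemma ev_proba n Q : P (ev n Q) = (pr m n Q)%:E.
Proof.
rewrite /ev (@evs_proba n) ?filter_uniq ?words_uniq //.
  by rewrite /pr big_filter.
by move=> w; rewrite mem_filter mem_words => /andP[_ /eqP].
Qed.

Lemma evP n Q om : ev n Q om <-> exists w, [/\ size w = n, Q w & cyl w om].
Proof.
split=> [[w]|[w [wn Qw H]]].
  by rewrite mem_filter mem_words => /andP[Qw /eqP wn] H; exists w.
by exists w => //; rewrite mem_filter mem_words Qw wn /=.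
Qed.

Lemma proba_bigcap_ge (F : nat -> set Omega) (c : R) :
  (forall n, measurable (F n)) -> (forall n, F n.+1 `<=` F n) ->
  (forall n, (c%:E <= P (F n))%E) -> (c%:E <= P (\bigcap_n F n))%E.
Proof.
move=> mF dF cF.
have cv : (P \o F) @ \oo --> P (\bigcap_n F n).
  apply: nonincreasing_cvg_mu => //; first by rewrite ltey_eq fin_num_measure.
    exact: bigcap_measurable.
  by apply/nonincreasing_seqP => n; apply/subsetPset.
rewrite -(cvg_lim _ cv) //; apply: lime_ge; first by apply/cvg_ex; exists (P (\bigcap_n F n)).
by apply: nearW => n; exact: cF.
Qed.

Section Convergence.
Context {E : Type} (act : I -> E -> E) (D : E -> R) (u : E) (p : R).
Hypotheses (D0 : forall e, 0 <= D e) (DS : forall e, avg m act D e <= D e)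
  (Hp : forall eps f, 0 < eps -> barrier m act (fun e => D e <= eps) f -> p <= f u).

(** The event that [D] is eventually below [lam], expressed by finite words to keep it
    measurable. *)
Definition small lam : set Omega :=
  \bigcup_n \bigcap_l ev (n + l) (fun w => `[< D (run act u w) < lam >]).

Lemma small_measurable lam : measurable (small lam).
Proof.
apply: bigcup_measurable => n _; apply: bigcap_measurable => // l _.
exact: ev_measurable.
Qed.

(** With probability above [p - eta / 2] the value of [D] drops to [eps] within [n] steps, and a
    later return to [lam] has probability at most [eps / lam], that is [eta / 2]. *)
Lemma small_proba lam : 0 < lam -> (p%:E <= P (small lam))%E.
Proof.
move=> lam0; apply/lee_addgt0Pr => eta eta0.
rewrite -leeBlDr // -EFinB.
have eta20 : 0 < eta / 2 by rewrite divr_gt0.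
pose eps := lam * (eta / 2); have eps0 : 0 < eps by rewrite mulr_gt0.
have [n Hn] := hitp_approx m_gt0 m_sum (e := u) (fun f => @Hp eps f eps0) eta20.
pose F l := ev (n + l) (fun w => hits act (fun e => D e <= eps) u (take n w)
  && ~~ excursion act D eps lam u w).
apply: (@le_trans _ _ (P (\bigcap_l F l))).
  apply: proba_bigcap_ge => [l|l om|l]; first exact: ev_measurable.
    move=> /evP[w [wn /andP[h1 h2] H]]; apply/evP.
    exists (take (n + l) w); split.
    - by rewrite size_takel // wn addnS.
    - rewrite take_takel ?leq_addr // h1 /=.
      by apply: contraNN h2; exact: excursion_take.
    - exact: cyl_take H.
  rewrite ev_proba lee_fin; apply: le_trans (pr_diff _ _ _ _) => //.
  rewrite pr_hits //; have := pr_excursion m_gt0 m_sum D0 DS (ltW eps0) lam0 u (n + l).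
  by rewrite /eps mulrAC divff ?gt_eqF // mul1r; lra.
apply: le_measure; rewrite ?inE.
- by apply: bigcap_measurable => // l _; exact: ev_measurable.
- exact: small_measurable.
move=> om H; exists n => // l _; have /evP[w [wn /andP[h1 h2] Hw]] := H l Logic.I.
apply/evP; exists w; split=> //; apply/asboolP; apply: excursionP h2.
exact: hits_take h1.
Qed.

(** The words stay in the conclusion because increments are known to be letters only on
    cylinders. *)
Lemma vanishing_event : exists A : set Omega, [/\ measurable A, (p%:E <= P A)%E &
  forall om, A om -> forall lam, 0 < lam -> exists N, forall n, (N <= n)%N ->
    exists w, [/\ size w = n, cyl w om & D (run act u w) < lam]].
Proof.
exists (\bigcap_n small n.+1%:R^-1); split.
- by apply: bigcap_measurable => // n _; exact: small_measurable.
- apply: proba_bigcap_ge => [n|n om|n]; first exact: small_measurable.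
    move=> [N _ HN]; exists N => // l _; have /evP[w [wn /asboolP h H]] := HN l Logic.I.
    apply/evP; exists w; split=> //; apply/asboolP; apply: lt_le_trans h _.
    by rewrite lef_pV2 ?posrE // ler_nat.
  exact: small_proba.
move=> om Aom lam lam0.
have [N _ HN] := Aom (Num.bound lam^-1) Logic.I.
exists N => n Nn; have /evP[w [wn /asboolP h H]] := HN (n - N)%N Logic.I.
exists w; split=> //; first by rewrite wn subnKC.
apply: lt_trans h _; rewrite -[ltRHS]invrK ltf_pV2 ?posrE ?invr_gt0 //.
apply: lt_trans (archi_boundP _) _; first by rewrite invr_ge0 ltW.
by rewrite ltr_nat.
Qed.

End Convergence.
End Process.

(** * Walks driven by homeomorphisms *)

Section HomeoWalk.
Context {R : realType} (mu : homeo R -> R).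
Hypotheses (mu_proba : finitely_supported_probability mu)
  (mu_sym : symmetric_measure mu).
Variable phi : homeo R.
Hypothesis phi_plus : forall k, msupport mu k -> homeo_plus (phi * k / phi)%g.
Local Notation G := (generated (msupport mu)).

Definition letter : finType := fset_set (msupport mu).

Lemma letterP (i : letter) : msupport mu (val i).
Proof.
have [_ fin _] := mu_proba.
by have := valP i; rewrite in_fset_set // inE.
Qed.

Fact letter_inv_subproof (i : letter) : (val i)^-1%g \in fset_set (msupport mu).
Proof.
have [_ fin _] := mu_proba; rewrite in_fset_set // inE /msupport /=.
by rewrite -mu_sym; exact: letterP.
Qed.

Definition letter_inv (i : letter) : letter := FSetSub (letter_inv_subproof i).

Fact letter_gt0 (i : letter) : 0 < mu (val i).
Proof.
have [mu0 _ _] := mu_proba.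
by rewrite lt_neqAle eq_sym mu0 andbT; exact: letterP.
Qed.

Fact letter_sum : \sum_(i : letter) mu (val i) = 1.
Proof.
by have [_ fin <-] := mu_proba; rewrite fsbig_finite //= big_seq_fsetE.
Qed.

Fact letter_invK : involutive letter_inv.
Proof. by move=> i; apply: val_inj => /=; rewrite invgK. Qed.

(** Building the conjugation into the action lets one walk serve both claims; the first takes [phi]
    to be 1. *)
Definition letter_act (i : letter) (x : R) : R := (phi * val i / phi)%g x.

Fact letter_act_lt i x y : x < y -> letter_act i x < letter_act i y.
Proof. exact: (phi_plus (letterP i)). Qed.

Fact letter_actK i : cancel (letter_act i) (letter_act (letter_inv i)).
Proof. by move=> x; rewrite /letter_act /= homeo_funK homeo_funK homeo_invK. Qed.

Definition homeo_walk : symwalk R letter :=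
  @SymWalk R letter (fun i => mu (val i)) letter_inv letter_act letter_gt0
    letter_sum (fun i => esym (mu_sym (val i))) letter_invK letter_act_lt letter_actK.

Local Notation s := (mov homeo_walk).

Lemma generated_word k : G k -> exists w, forall x, run s x w = (phi * k / phi)%g x.
Proof.
apply: (@smallest_sub _ (@subgroup_of_type (homeo R)) (msupport mu)
  [set k | exists w, forall x, run s x w = (phi * k / phi)%g x]).
  split.
  - by exists [::] => x /=; rewrite homeo_invK.
  (* Words are run from left to right, so the word of the right factor comes first. *)
  - move=> a b [v Hv] [w Hw]; exists (w ++ v) => x.
    by rewrite run_cat Hw Hv /= homeo_funK.
  - move=> a [w Hw]; exists (word_inv homeo_walk w) => x.
    set y := RHS; rewrite -[RHS](run_word_inv homeo_walk y w) Hw.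
    by rewrite /y /= homeo_funK homeo_invK homeo_invK.
move=> q mq /=; have [_ fin _] := mu_proba.
have qX : q \in fset_set (msupport mu) by rewrite in_fset_set // inE.
by exists [:: (FSetSub qX : letter)].
Qed.

Lemma homeo_walk_minimal : minimal_action G -> minimal_walk homeo_walk.
Proof.
move=> Gmin x a b ab.
have oab : open ((phi : R -> R) @^-1` `]a, b[%classic).
  apply: open_comp; last exact: interval_open.
  by move=> z _; exact: homeo_fun_continuous.
have nab : (phi : R -> R) @^-1` `]a, b[%classic !=set0.
  exists (homeo_inv phi ((a + b) / 2)); rewrite /= homeo_invK in_itv /=.
  by apply/andP; split; lra.
have [z [/= + [k Gk kz]]] := Gmin (homeo_inv phi x) _ nab oab.
rewrite in_itv /= -kz => /andP[ak kb].
by have [w Hw] := generated_word Gk; exists w; rewrite Hw.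
Qed.

Lemma contractible_word l0 l1 a b : a <= b ->
  contractible_into (conjugate_set phi G) `[l0, l1]%classic `[a, b]%classic ->
  contracts homeo_walk l0 l1 a b.
Proof.
move=> ab [k [Gk kL kd]] eps eps0.
have /cvgrPdist_lt/(_ eps eps0)[N _ /(_ N (leqnn N))] := kd.
rewrite /= sub0r normrN => kN.
have [q Gq qk] := Gk N; have [w Hw] := generated_word Gq.
have aI : `[a, b]%classic a by rewrite /= in_itv /= lexx.
have bI : `[a, b]%classic b by rewrite /= in_itv /= lexx andbT.
have kE x : k N x = run s x w by rewrite Hw -qk.
have ka : `[l0, l1]%classic (k N a) by apply: kL; exists a.
have kb : `[l0, l1]%classic (k N b) by apply: kL; exists b.
move: (ka) (kb); rewrite /= !in_itv /= => /andP[ka1 ka2] /andP[kb1 kb2].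
exists w; rewrite -!kE; split=> //.
apply: le_lt_trans (le_lt_trans (ler_norm _) kN).
apply: le_trans (ler_norm _) _; apply: ub_le_sup; last first.
  by exists (k N b, k N a) => //=; split; [exists b|exists a].
exists (l1 - l0) => _ [[u v] [/= Iu Iv] <-].
have := kL N u Iu; have := kL N v Iv; rewrite /= !in_itv /= => /andP[? ?] /andP[? ?].
by rewrite ler_norml; apply/andP; split; lra.
Qed.

Lemma diameter_itv (a b : R) : a <= b -> diameter `[a, b]%classic <= b - a.
Proof.
move=> ab; apply: ge_sup.
  by exists `|a - a|, (a, a) => //=; rewrite !in_itv /= lexx ab.
move=> _ [[u v] [/= + +] <-]; rewrite !in_itv /= => /andP[? ?] /andP[? ?].
by rewrite ler_norml; apply/andP; split; lra.
Qed.

Context d (Omega : measurableType d) (P : probability Omega R).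
Variable g : nat -> Omega -> homeo R.
Hypothesis g_iid : iid_with_law P mu g.

Lemma trajectory_run x w om : cyl (fun i : letter => val i) g w om ->
  trajectory (fun n w' => (phi * g n w' / phi)%g) x (size w) om = run s x w.
Proof.
elim/last_ind: w => [|w i IH] H //; rewrite size_rcons -cats1 run_cat.
have {}IH := IH _; rewrite /trajectory /= in IH *.
rewrite IH; last first.
  by have := cyl_take (n := size w) H; rewrite -cats1 take_size_cat.
have -> : g (size w) om = val i.
  rewrite H ?size_rcons ?mem_iota ?ltnSn //.
  by rewrite map_rcons nth_rcons size_map ltnn eqxx.
by [].
Qed.

(** The common end of both claims: [p] is 1 under strong contraction and the positive bound of
    [weak_hit] under weak contraction. *)
Lemma local_contraction_event h x y p J :
  (forall x y, x < y -> h x < h y) -> harmonic homeo_walk h ->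
  (forall eps f, 0 < eps ->
    barrier (wt homeo_walk) (mov2 homeo_walk) (fun u => gap h u <= eps) f -> p <= f (x, y)) ->
  x < y -> compact_interval J ->
  exists A : set Omega, [/\ measurable A, (p%:E <= P A)%E &
    A `<=` [set w | local_contraction (fun n w' => (phi * g n w' / phi)%g) x y J w]].
Proof.
move=> hlt hh Hp xy [j0 [j1 [_ ->]]].
have DS u : avg (wt homeo_walk) (mov2 homeo_walk) (gap h) u <= gap h u.
  by rewrite gap_harmonic.
have [A [mA pA HA]] := @vanishing_event R letter (wt homeo_walk) (wt_gt0 _) (wt_sum _)
  _ (fun i : letter => val i) val_inj mu (fun=> erefl) _ _ P g g_iid _ (mov2 homeo_walk)
  (gap h) (x, y) p (gap_ge0 h) DS Hp.
exists A; split=> // om Aom; have {}HA := HA om Aom.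
(* Prefixes of long words show that on [A] the increments are letters at all times, small [n]
   included. *)
have allw n : exists w, size w = n /\ cyl (fun i : letter => val i) g w om.
  have [N HN] := HA 1 ltr01; have [w [wn cw _]] := HN (N + n)%N (leq_addr _ _).
  exists (take n w); split; last exact: cyl_take.
  by rewrite size_takel // wn leq_addl.
apply: (vanishing_gap hlt).
  move=> n /=; have [w [<- cw]] := allw n.
  by rewrite [ltLHS](trajectory_run x cw) [ltRHS](trajectory_run y cw); exact: run_lt.
move=> e e0; have [N HN] := HA e e0; exists N => n /HN[w [<- cw]] /=.
rewrite run_mov2 (gapE hlt); last by apply: run_le; exact: ltW.
move=> Dw; rewrite [X in h X - _](trajectory_run y cw).
by rewrite [X in _ - h X](trajectory_run x cw).
Qed.


End HomeoWalk.

Lemma generated_sub (T : groupType) (S : set T) : S `<=` generated S.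
Proof. exact: sub_gen_smallest. Qed.

Lemma conjugate_set1 (T : groupType) (S : set T) : conjugate_set 1%g S = S.
Proof.
apply/seteqP; split=> k; first by move=> [q Sq <-]; rewrite mul1g divg1.
by move=> Sk; exists k; rewrite ?mul1g ?divg1.
Qed.

Unset Implicit Arguments.

Theorem theorem7p2 (R : realType) (mu : homeo R -> R)
    (mu_homeo_plus : msupport mu `<=` @homeo_plus R)
    (mu_proba : finitely_supported_probability mu)
    (mu_sym : symmetric_measure mu)
    (mu_irr : irreducible_measure mu)
    (G_minimal : minimal_action (generated (msupport mu)))
    (d : measure_display) (Omega : measurableType d) (P : probability Omega R)
    (g : nat -> Omega -> homeo R) (g_iid : iid_with_law P mu g) :
  (strong_contraction (generated (msupport mu)) ->
     forall (x y : R) (J : set R), x < y -> compact_interval J ->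
       {ae P, forall w, local_contraction g x y J w})
  /\
  (~ strong_contraction (generated (msupport mu)) ->
     forall phi : homeo R,
       conjugate_set phi (generated (msupport mu)) `<=` @homeo_circle_lift R ->
       weak_contraction (conjugate_set phi (generated (msupport mu))) ->
       forall (x y : R) (J : set R), x < y -> y < x + 1 -> compact_interval J ->
         holds_with_positive_probability P
           [set w | local_contraction (fun n w' => (phi * g n w' / phi)%g)
                      x y J w]).
Proof.
split.
  move=> [L [l0 [l1 [_ ->]]] strong] x y J xy cJ.
  have plus k : msupport mu k -> homeo_plus (1 * k / 1)%g.
    by move=> /mu_homeo_plus; rewrite mul1g divg1.
  pose W := homeo_walk mu_proba mu_sym plus.
  have Wmin : minimal_walk W by exact: homeo_walk_minimal.
  have [h [hlt hh hcont hunb]] := harmonic_coordinate Wmin.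
  have Wstrong : exists l0 l1, forall a b, a <= b -> contracts W l0 l1 a b.
    exists l0, l1 => a b ab; apply: contractible_word => //; rewrite conjugate_set1.
    by apply: strong; exists a, b.
  have [||//|A [mA pA HA]] :=
    local_contraction_event g_iid (x := x) (y := y) (p := 1) (J := J) hlt hh.
  - by move=> eps f eps0 bf; apply: (strong_hit Wmin hlt hh hcont hunb Wstrong eps0 bf).
  - by [].
  exists (~` A); split; first exact: measurableC.
    have PA1 : P A = 1%E by apply/eqP; rewrite eq_le pA probability_le1.
    by have := probability_setC P mA; rewrite PA1 subee.
  move=> w nw Aw; apply: nw; have := HA w Aw.
  rewrite /= (_ : (fun n w' => (1 * g n w' / 1)%g) = g) //.
  by apply/funext => n; apply/funext => w'; rewrite mul1g divg1.
move=> _ phi lift [L [l0 [l1 [_ ->]]] weak] x y J xy yx cJ.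
have lift1 k : msupport mu k -> homeo_circle_lift (phi * k / phi)%g.
  by move=> mk; apply: lift; exists k => //; exact: generated_sub.
have plus k : msupport mu k -> homeo_plus (phi * k / phi)%g.
  by move=> /lift1[].
pose W := homeo_walk mu_proba mu_sym plus.
have Wmin : minimal_walk W by exact: homeo_walk_minimal.
have [h [hlt hh hcont hunb]] := harmonic_coordinate Wmin.
have periodic i z : mov W i (z + 1) = mov W i z + 1.
  by have [_] := lift1 _ (letterP mu_proba i); apply.
have Wweak : exists l0 l1, forall a b, a <= b -> b - a < 1 -> contracts W l0 l1 a b.
  exists l0, l1 => a b ab ab1; apply: contractible_word => //.
  by apply: weak; [exists a, b|exact: le_lt_trans (diameter_itv ab) ab1].
have [p p0 Hp] := weak_hit Wmin hlt hh hcont periodic Wweak (u := (x, y)) xy yx.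
have [A [mA pA HA]] := local_contraction_event g_iid hlt hh Hp xy cJ.
by exists A; split=> //; apply: lt_le_trans pA; rewrite lte_fin.
Qed.
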